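(* Let $(X,d)$ be a complete separable metric space which is doubling and uniformly perfect, and let $\mathcal{K}(X)$ be the set of nonempty compact subsets of $X$ equipped with the Hausdorff metric $d_H$. Schmidt's game is played on the complete metric space $(\mathcal{K}(X),d_H)$. Then: (i) The set $\{K\in\mathcal{K}(X) : \dim_A K<\dim_A X\}$ is winning. (ii) If furthermore $\overline{\dim_B}\,X<\infty$, then the set $\{K\in\mathcal{K}(X) : \underline{\dim_B}\,K<\overline{\dim_B}\,X\}$ is winning.
   Context: **Schmidt's game.** Let $(Y,\rho)$ be a complete metric space and $0<\alpha,\beta<1$. The $(\alpha,\beta)$-game between Alice and Bob: Bob first chooses $r_0>0$ and $x_0\in Y$. Put $r_n=(\alpha\beta)^n r_0$. For $n=1,2,\dots$: Alice chooses $y_n\in Y$ with $\rho(x_{n-1},y_n)+\alpha r_{n-1}\le r_{n-1}$; then Bob chooses $x_n\in Y$ with $\rho(y_n,x_n)+\alpha\beta r_{n-1}\le \alpha r_{n-1}$. The closed balls $B_n=B(x_n,r_n)$ and $A_n=B(y_n,\alpha r_{n-1})$ satisfy $B_0\supseteq A_1\supseteq B_1\supseteq A_2\supseteq\cdots$ and intersect in a unique point, called the outcome. A set $S\subseteq Y$ is $(\alpha,\beta)$-winning if Alice has a strategy guaranteeing that the outcome lies in $S$; it is $\alpha$-winning if it is $(\alpha,\beta)$-winning for all $0<\beta<1$; it is winning if it is $\alpha$-winning for some $0<\alpha<1$. **Dimensions.** For a subset $K$ of a metric space, $N_r(K)$ denotes the minimal number (possibly $\infty$) of open sets of diameter at most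 $r$ required to cover $K$; $B(x,R)$ is the closed ball. For nonempty $K$: - The Assouad dimension $\dim_A K$ is the infimum of all $s\ge 0$ for which there is a constant $C>0$ such that for all $0<r<R$ and all $x\in K$, $N_r(B(x,R)\cap K)\le C(R/r)^s$ ($\dim_A K=\infty$ if there is no such $s$). - The lower dimension $\dim_L K$ is the supremum of all $s\ge 0$ for which there is a constant $C>0$ such that for all $0<r<R\le\max\{\mathrm{diam}(K),1\}$ and all $x\in K$, $N_r(B(x,R)\cap K)\ge C(R/r)^s$. - The lower and upper box dimensions are $\underline{\dim_B}\,K=\liminf_{r\to0}\frac{\log N_r(K)}{-\log r}$ and $\overline{\dim_B}\,K=\limsup_{r\to0}\frac{\log N_r(K)}{-\log r}$. **Properties of $X$.** $X$ is doubling if $\dim_A X<\infty$. $X$ is uniformly perfect if $\dim_L X>0$. *)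

(* Defs.v *)
From HB Require Import structures.
From mathcomp Require Import all_boot all_order all_algebra.
From mathcomp Require Import all_classical all_reals all_analysis.

Set Implicit Arguments.
Unset Strict Implicit.
Unset Printing Implicit Defensive.

Import Order.TTheory GRing.Theory Num.Theory.
Import numFieldNormedType.Exports.

Local Open Scope classical_set_scope.
Local Open Scope ring_scope.

(* [Complete] includes a base point, so these spaces are nonempty. *)
#[short(type="completeMetricType")]
HB.structure Definition CompleteMetric (R : numDomainType) :=
  { T of Complete T & Metric R T }.

Definition separable (T : topologicalType) : Prop :=
  exists2 D : set T, countable D & dense D.

Section dimensions.
Context {R : realType} {X : metricType R}.
Implicit Types (K A : set X) (x : X) (r s C : R).

(* The library's [closed_ball] is the closure of the open ball, which can be
   strictly smaller. *)
Definition cball x r : set X := [set y | mdist x y <= r].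

(* The added 0 only matters for the empty set, where the supremum alone would
   be -oo. *)
Definition diam A : \bar R :=
  ereal_sup (0%E |` [set (mdist p.1 p.2)%:E | p in A `*` A]).

Definition coverable r K (n : nat) : Prop :=
  exists U : 'I_n -> set X,
    (forall i, open (U i) /\ (diam (U i) <= r%:E)%E) /\
    K `<=` \bigcup_(i in [set: 'I_n]) U i.

(* [ereal_inf set0 = +oo] covers the case where no finite cover exists. *)
Definition covering_number r K : \bar R :=
  ereal_inf [set (n%:R : R)%:E | n in coverable r K].

Definition assouad_dim K : \bar R :=
  ereal_inf [set s%:E | s in [set s | 0 <= s /\
    exists2 C, 0 < C &
      forall r q x, 0 < r -> r < q -> K x ->
        (covering_number r (cball x q `&` K) <= (C * (q / r) `^ s)%:E)%E]].

Definition lower_dim K : \bar R :=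
  ereal_sup [set s%:E | s in [set s | 0 <= s /\
    exists2 C, 0 < C &
      forall r q x, 0 < r -> r < q -> (q%:E <= maxe (diam K) 1)%E -> K x ->
        ((C * (q / r) `^ s)%:E <= covering_number r (cball x q `&` K))%E]].

Definition box_ratio K r : \bar R :=
  (lne (covering_number r K) / (- ln r)%:E)%E.

Definition lower_box_dim K : \bar R := limf_einf (box_ratio K) 0^'+.

Definition upper_box_dim K : \bar R := limf_esup (box_ratio K) 0^'+.

End dimensions.

Definition doubling (R : realType) (X : metricType R) : Prop :=
  (assouad_dim [set: X] < +oo)%E.

Definition uniformly_perfect (R : realType) (X : metricType R) : Prop :=
  (0 < lower_dim [set: X])%E.

Section schmidt_game.
Context {R : realType} {Y : metricType R}.
Implicit Types (S : set Y) (x : nat -> Y).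

(* In step n + 1 (where r is r_n), Alice answers Bob's x_n with y_(n+1)... *)
Definition alice_legal (alpha r : R) (xn y : Y) : Prop :=
  mdist xn y + alpha * r <= r.

(* ... and Bob answers y_(n+1) with x_(n+1). *)
Definition bob_legal (alpha beta r : R) (y xn1 : Y) : Prop :=
  mdist y xn1 + alpha * beta * r <= alpha * r.

(* A strategy maps r_0 and Bob's previous centres [:: x_0; ...; x_n] to
   y_(n+1); Alice's own previous moves are determined by these data. *)
Definition strategy := R -> seq Y -> Y.

Definition alice_move (sigma : strategy) (r0 : R) x (n : nat) : Y :=
  sigma r0 (mkseq x n.+1).

Definition winning_with (alpha beta : R) S : Prop :=
  exists sigma : strategy, forall (r0 : R) x, 0 < r0 ->
    let r n := (alpha * beta) ^+ n * r0 in
    let y := alice_move sigma r0 x in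
    let bob n := bob_legal alpha beta (r n) (y n) (x n.+1) in
    (forall n, (forall i, (i < n)%N -> bob i) ->
       alice_legal alpha (r n) (x n) (y n)) /\
    ((forall n, bob n) ->
       exists2 z, \bigcap_n cball (x n) (r n) = [set z] & S z).

Definition winning_for (alpha : R) S : Prop :=
  forall beta : R, 0 < beta < 1 -> winning_with alpha beta S.

Definition winning S : Prop :=
  exists2 alpha : R, 0 < alpha < 1 & winning_for alpha S.

End schmidt_game.

Record compacts (R : realType) (X : metricType R) := Compacts {
  cset :> set X;
  cset_compact : compact cset;
  cset_neq0 : cset !=set0 }.
Arguments cset_compact {R X} _.

HB.instance Definition _ R X := gen_eqMixin (@compacts R X).
HB.instance Definition _ R X := gen_choiceMixin (@compacts R X).

Section hausdorff_metric.
Context {R : realType} {X : metricType R}.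
Implicit Types (x y : X) (A B : set X) (K L M : compacts X).

Definition dist_to x A : R := inf [set mdist x a | a in A].

Definition excess A B : R := sup [set dist_to a B | a in A].

Definition hausdorff_dist A B : R := Num.max (excess A B) (excess B A).

Lemma mdist_continuous x : continuous (mdist x : X -> R).
Proof.
move=> y; apply/cvgrPdist_le => e e0; near=> z.
have zy : mdist y z <= e.
  by near: z; exact: metricType_numDomainType.cvgr_dist_le (@cvg_id _ _) _ e0.
rewrite ler_norml; apply/andP; split.
- rewrite lerBrDr addrC lerBlDr (le_trans (metric_triangle x y z))//.
  by rewrite lerD2l.
- rewrite lerBlDr (le_trans (metric_triangle x z y))// addrC lerD2r.
  by rewrite metric_sym.
Unshelve. all: by end_near. Qed.

Lemma compacts_bounded x K : exists m : R, forall a, cset K a -> mdist x a <= m.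
Proof.
have [c _ cM] := @compact_EVT_max X R (mdist x) (cset K) (cset_neq0 K)
  (cset_compact K) (continuous_subspaceT (@mdist_continuous x)).
by exists (mdist x c) => a Ka; apply: cM; rewrite inE.
Qed.

Lemma has_inf_dist_to x A : A !=set0 -> has_inf [set mdist x a | a in A].
Proof.
move=> [a Aa]; split; first by exists (mdist x a), a.
by exists 0 => _ [b _ <-]; exact: mdist_ge0.
Qed.

Lemma dist_to_le x A a : A a -> dist_to x A <= mdist x a.
Proof.
move=> Aa; apply: ge_inf; last by exists a.
by have [] : has_inf [set mdist x a | a in A] by apply: has_inf_dist_to; exists a.
Qed.

Lemma dist_to_ge0 x A : A !=set0 -> 0 <= dist_to x A.
Proof.
move=> A0; apply: lb_le_inf; first by case: (has_inf_dist_to x A0).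
by move=> _ [b _ <-]; exact: mdist_ge0.
Qed.

Lemma dist_to_lt x A e : A !=set0 -> dist_to x A < e ->
  exists2 a, A a & mdist x a < e.
Proof.
move=> A0 /inf_lt[|_ [a Aa <-] ?]; first by case: (has_inf_dist_to x A0).
by exists a.
Qed.

Lemma excess_ge K L a : cset K a -> dist_to a L <= excess K L.
Proof.
move=> Ka; apply: ub_le_sup; last by exists a.
have [l Ll] := cset_neq0 L; have [m Km] := compacts_bounded l K.
exists m => _ [b Kb <-]; rewrite (le_trans (dist_to_le _ Ll))//.
by rewrite metric_sym Km.
Qed.

Lemma excess_le K L e : (forall a, cset K a -> dist_to a L <= e) ->
  excess K L <= e.
Proof.
move=> Kle; apply: ge_sup; last by move=> _ [a Ka <-]; exact: Kle.
by have [a Ka] := cset_neq0 K; exists (dist_to a L), a.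
Qed.

Lemma excess_ge0 K L : 0 <= excess K L.
Proof.
have [a Ka] := cset_neq0 K; apply: le_trans (excess_ge L Ka).
exact/dist_to_ge0/cset_neq0.
Qed.

Lemma excess_triangle L K M : excess K M <= excess K L + excess L M.
Proof.
apply: excess_le => a Ka; apply/ler_addgt0Pr => e e0.
have [|l Ll al] := @dist_to_lt a L (dist_to a L + e / 2) (cset_neq0 L).
  by rewrite ltrDl divr_gt0.
have [|m Mm lm] := @dist_to_lt l M (dist_to l M + e / 2) (cset_neq0 M).
  by rewrite ltrDl divr_gt0.
rewrite (le_trans (dist_to_le a Mm))// (le_trans (metric_triangle a l m))//.
rewrite (le_trans (lerD (ltW al) (ltW lm)))// addrACA -splitr lerD2r.
by rewrite lerD// excess_ge.
Qed.

Lemma excess0_sub K L : excess K L <= 0 -> cset K `<=` cset L.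
Proof.
move=> KL0 a Ka.
have /closure_id -> : closed (cset L).
  exact: compact_closed (@metric_hausdorff _ X) (cset_compact L).
move=> B /nbhs_ballP[e /= e0 aeB].
have [|l Ll al] := @dist_to_lt a L e (cset_neq0 L).
  by rewrite (le_lt_trans _ e0)// (le_trans (excess_ge L Ka)).
by exists l; split=> //; apply: aeB; rewrite ballEmdist.
Qed.

Lemma hausdorff_distxx K : hausdorff_dist K K = 0.
Proof.
rewrite /hausdorff_dist maxxx; apply/eqP; rewrite eq_le excess_ge0 andbT.
by apply: excess_le => a Ka; rewrite (le_trans (dist_to_le a Ka))// mdistxx.
Qed.

Lemma hausdorff_dist_eq0 K L : hausdorff_dist K L = 0 -> K = L.
Proof.
move=> KL0; have /andP[/excess0_sub KL /excess0_sub LK] :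
    (excess K L <= 0) && (excess L K <= 0) by rewrite -ge_max -/(hausdorff_dist _ _) KL0.
case: K L KL LK {KL0} => [K cK K0] [L cL L0] /= KL LK.
have E : K = L by apply/seteqP.
by subst L; congr Compacts; exact: Prop_irrelevance.
Qed.

Lemma hausdorff_dist_sym K L : hausdorff_dist K L = hausdorff_dist L K.
Proof. by rewrite /hausdorff_dist maxC. Qed.

Lemma hausdorff_dist_triangle L K M :
  hausdorff_dist K M <= hausdorff_dist K L + hausdorff_dist L M.
Proof.
rewrite /hausdorff_dist ge_max; apply/andP; split.
- by rewrite (le_trans (excess_triangle L K M))// lerD// le_max lexx.
- rewrite (le_trans (excess_triangle L M K))// addrC.
  by rewrite lerD// le_max lexx orbT.
Qed.

HB.instance Definition _ := @isMetric.Build R (compacts X)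
  (fun K L => hausdorff_dist K L)
  hausdorff_distxx hausdorff_dist_eq0 hausdorff_dist_sym
  hausdorff_dist_triangle.

End hausdorff_metric.

(* Main.v *)
Require Import Defs.
From HB Require Import structures.
From mathcomp Require Import all_boot all_order all_algebra.
From mathcomp Require Import all_classical all_reals all_analysis.
From mathcomp Require Import ring lra.

Set Implicit Arguments.
Unset Strict Implicit.
Unset Printing Implicit Defensive.

Import Order.TTheory GRing.Theory Num.Theory.
Import numFieldNormedType.Exports.

Local Open Scope classical_set_scope.
Local Open Scope ring_scope.

(** Fix t > dim X. Let mass A be the supremum of sum_i rho_i^t over finite
    families of pairwise disjoint balls of dyadic radii rho_i <= 1 contained in
    A. It is superadditive on disjoint sets, mass (cball x rho) >= (rho/2)^t is
    trivial, and since t exceeds the dimension, counting balls scale by scale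
    gives mass (cball x rho) <= c rho^t for the Assouad dimension, and
    mass X < oo for the box dimension.

    Alice, facing K and r, takes a maximal r/2-separated set F in K. Uniform
    perfectness yields, in each cball f (r/4) with f in F, two disjoint balls of
    radius alpha r (with alpha independent of beta); she replaces f by the centre
    of the one with the smaller mass. Hence the total mass of the balls she
    selects is at least halved in every round, so that after n rounds at most
    2^-n c (alpha beta)^(-nt) balls of radius alpha (alpha beta)^n r_0 are left.
    As t may be chosen arbitrarily close to the dimension, the factor 2^-n brings
    the exponent below it. *)

(** * Coverings and separated sets *)

Section coverings.
Context {R : realType} {X : metricType R}.
Implicit Types (K A : set X) (x y : X) (s : seq X).

Lemma cball_center x (r : R) : 0 <= r -> cball x r x.
Proof. by rewrite /cball/= mdistxx. Qed.

Lemma cball_sub x y (r q : R) : mdist x y + q <= r -> cball y q `<=` cball x r.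
Proof.
move=> xyr z /= yz; apply: le_trans (metric_triangle x y z) _.
by apply: le_trans xyr; rewrite lerD2l.
Qed.

Lemma diam_mdist A (r : R) x y : (diam A <= r%:E)%E -> A x -> A y ->
  mdist x y <= r.
Proof.
move=> Ar Ax Ay; rewrite -lee_fin; apply: le_trans Ar.
by apply: ereal_sup_ubound; right; exists (x, y).
Qed.

Lemma diam_le A (r : R) : 0 <= r ->
  (forall x y, A x -> A y -> mdist x y <= r) -> (diam A <= r%:E)%E.
Proof.
move=> r0 Ar; apply: ge_ereal_sup => _ [->|[[x y]/= [Ax Ay] <-]].
  by rewrite lee_fin.
by rewrite lee_fin Ar.
Qed.

Lemma metric_ball_open x (r : R) : open (ball x r).
Proof.
rewrite openE => y; rewrite ballEmdist/= => xy; apply/nbhs_ballP.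
exists (r - mdist x y) => /=; first by rewrite subr_gt0.
move=> z; rewrite ballEmdist/= => yz.
by rewrite (le_lt_trans (metric_triangle x y z))// -ltrBrDl.
Qed.

(** A covering set has diameter at most [delta], so it contains at most one point of the list; the
    pigeonhole principle concludes. *)
Lemma size_separated_le (delta : R) A n s : coverable delta A n ->
  pairwise (fun x y => delta < mdist x y) s -> (forall x, x \in s -> A x) ->
  (size s <= n)%N.
Proof.
move=> [U [Uo AU]] /pairwiseP sep sA.
have idx (i : 'I_(size s)) : exists j : 'I_n, U j (tnth (in_tuple s) i).
  by have [|j _ ?] := AU (tnth (in_tuple s) i); [exact/sA/mem_tnth|exists j].
have [f fU] := choice idx.
suff /leq_card : injective f by rewrite !card_ord.
have far (i j : 'I_(size s)) : (i < j)%N -> f i <> f j.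
  move=> ij fij; have x0 := tnth (in_tuple s) i.
  have := sep x0 i j (ltn_ord i) (ltn_ord j) ij.
  apply/negP; rewrite -leNgt; apply: diam_mdist (Uo (f i)).2 _ _.
    by have := fU i; rewrite (tnth_nth x0).
  by rewrite fij; have := fU j; rewrite (tnth_nth x0).
move=> i j fij; apply/val_inj; case: (ltngtP i j) => // ij.
  by case: (far _ _ ij).
by case: (far _ _ ij).
Qed.

(** The factor 4 arises because covers consist of open sets: each closed ball is enlarged to the
    open ball of radius [2 * rho], of diameter at most [4 * rho]. *)
Lemma coverable_cballs (delta rho : R) A s : 0 < rho -> 4 * rho <= delta ->
  A `<=` [set x | exists2 y, y \in s & cball y rho x] ->
  coverable delta A (size s).
Proof.
move=> rho0 rhod As; exists (fun i => ball (tnth (in_tuple s) i) (2 * rho)).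
split=> [i|x /As[y ys xy]].
  split; first exact: metric_ball_open.
  apply: diam_le => [|x y]; first by lra.
  rewrite !ballEmdist/= => ix iy.
  apply: le_trans (metric_triangle x (tnth (in_tuple s) i) y) _.
  by rewrite metric_sym; lra.
have iy : (index y s < size s)%N by rewrite index_mem.
exists (Ordinal iy) => //; rewrite ballEmdist (tnth_nth y)/= nth_index//.
by move: xy; rewrite /cball/=; lra.
Qed.

Lemma coverableS (r q : R) K A n : r <= q -> A `<=` K ->
  coverable r K n -> coverable q A n.
Proof.
move=> rq AK [U [Uo KU]]; exists U; split; last exact: subset_trans KU.
by move=> i; have [? ?] := Uo i; split=> //; rewrite (@le_trans _ _ r%:E).
Qed.

Lemma covering_number_le (r : R) K n : coverable r K n ->
  (covering_number r K <= (n%:R)%:E)%E.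
Proof. by move=> rKn; apply: ereal_inf_lbound; exists n. Qed.

Lemma covering_number_ge (r : R) K (c : \bar R) :
  (forall n, coverable r K n -> (c <= (n%:R)%:E)%E) ->
  (c <= covering_number r K)%E.
Proof. by move=> H; apply: le_ereal_inf_tmp => _ [n rKn <-]; exact: H. Qed.

Lemma covering_number_mono (r q : R) K A : r <= q -> A `<=` K ->
  (covering_number q A <= covering_number r K)%E.
Proof.
move=> rq AK; apply: covering_number_ge => n rKn.
exact/covering_number_le/(coverableS rq AK).
Qed.

Lemma covering_number_ge1 (r : R) K : K !=set0 ->
  (1 <= covering_number r K)%E.
Proof.
move=> [x Kx]; apply: covering_number_ge => -[[U [_ /(_ x Kx)[[]]//]]|n _].
by rewrite lee_fin ler1n.
Qed.

Lemma size_separated_covering (delta : R) A s :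
  pairwise (fun x y => delta < mdist x y) s -> (forall x, x \in s -> A x) ->
  (((size s)%:R)%:E <= covering_number delta A)%E.
Proof.
move=> sep sA; apply: covering_number_ge => n dAn.
by rewrite lee_fin ler_nat (size_separated_le dAn).
Qed.

(** Separated lists in [A] have length at most [n], so a longest one exists; a point farther than
    [delta] from all its members could be prepended to it. *)
Lemma maximal_separated (delta : R) A n : 0 <= delta -> coverable delta A n ->
  exists s, [/\ pairwise (fun x y => delta < mdist x y) s,
    forall x, x \in s -> A x &
    forall x, A x -> exists2 y, y \in s & mdist x y <= delta].
Proof.
move=> delta0 dAn.
pose P k := `[< exists s, [/\ pairwise (fun x y => delta < mdist x y) s,
  forall x, x \in s -> A x & size s = k] >].
have P0 : exists k, P k by exists 0; apply/asboolP; exists [::].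
have Pn k : P k -> (k <= n)%N.
  by move=> /asboolP[s [sep sA <-]]; exact: size_separated_le dAn sep sA.
have [k /asboolP[s [sep sA sk]] kmax] := ex_maxnP P0 Pn.
exists s; split=> // x Ax; apply: contrapT => H.
suff : P k.+1 by move=> /kmax; rewrite ltnn.
apply/asboolP; exists (x :: s); split; last by rewrite /= sk.
  rewrite pairwise_cons sep andbT; apply/allP => y ys.
  by rewrite ltNge; apply/negP => xy; apply: H; exists y.
by move=> y; rewrite inE => /predU1P[->//|/sA].
Qed.

End coverings.

Lemma compact_coverable (R : realType) (X : completeMetricType R)
  (K : set X) (delta : R) : 0 < delta -> compact K ->
  exists n, coverable delta K n.
Proof.
move=> d0; rewrite compact_cover => cK.
have [|x Kx|D _ KD] := cK X K (fun x => ball x (delta / 4)).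
- by move=> x _; exact: metric_ball_open.
- by exists x => //; rewrite ballEmdist/= mdistxx divr_gt0.
exists (size (finmap.enum_fset D)); apply: (@coverable_cballs _ _ _ (delta / 4)).
- by rewrite divr_gt0.
- by lra.
move=> x /KD[y /= yD]; rewrite ballEmdist/= => xy.
by exists y => //; rewrite /cball/= ltW.
Qed.

(** * Packing mass *)

Lemma powRV (R : realType) (a r : R) : 0 <= a -> a^-1 `^ r = (a `^ r)^-1.
Proof. by move=> a0; rewrite -powR_inv1// -powRrM mulN1r powRN. Qed.

Lemma exists_expr_le (R : realType) (a e : R) : 0 < a -> a < 1 -> 0 < e ->
  exists n, a ^+ n <= e.
Proof.
move=> a0 a1 e0.
have /cvgrPdist_lt/(_ e e0)[N _ /(_ N)/=] : a ^+ n @[n --> \oo] --> 0.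
  by apply: cvg_expr; rewrite ger0_norm// ltW.
rewrite leqnn sub0r normrN ger0_norm ?exprn_ge0 ?(ltW a0)// => /(_ isT) h.
by exists N; rewrite ltW.
Qed.

Lemma half_powR_lt1 (R : realType) (a : R) : 0 < a -> 0 < 1 - 2^-1 `^ a.
Proof.
move=> a0; have : (2^-1 : R) `^ a < 1 `^ a.
  by apply: gt0_ltr_powR => //; rewrite ?nnegrE ?invf_lt1 ?invr_ge0 ?ltr1n.
by rewrite powR1 subr_gt0.
Qed.

Section mass.
Context {R : realType} {X : metricType R}.
Variable t : R.
Implicit Types (A B : set X) (s : seq (nat * X)).

(** The pair is (level, centre). Dyadic radii let the balls of a packing be counted level by level,
    and the pair records radius and centre, which the ball as a set need not determine. *)
Definition pball (p : nat * X) : set X := cball p.2 (2^-1 ^+ p.1 : R).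

Definition packing A s : Prop := [/\ uniq s,
  forall p, p \in s -> pball p `<=` A &
  forall p q, p \in s -> q \in s -> p != q -> pball p `&` pball q = set0].

Definition weight s : R := \sum_(p <- s) (2^-1 ^+ p.1) `^ t.

Definition mass A : R := sup [set weight s | s in packing A].

(** On an unbounded set [sup] takes a default value, so lower bounds on [mass] rest on this
    condition. *)
Definition finite_mass A : Prop := has_ubound [set weight s | s in packing A].

Lemma pball_center p : pball p p.2.
Proof. by apply: cball_center; rewrite exprn_ge0// invr_ge0. Qed.

Lemma packing0 A : packing A [::].
Proof. by split. Qed.

Lemma packingS A B s : A `<=` B -> packing A s -> packing B s.
Proof. by move=> AB [? sA ?]; split=> // p ps; apply: subset_trans AB; exact: sA. Qed.

Lemma finite_massS A B : A `<=` B -> finite_mass B -> finite_mass A.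
Proof.
move=> AB [c Bc]; exists c => _ [s sA <-]; apply: Bc.
by exists s => //; exact: packingS sA.
Qed.

Lemma has_sup_mass A : finite_mass A -> has_sup [set weight s | s in packing A].
Proof.
move=> fA; split=> //; exists (weight [::]), [::] => //.
Qed.

Lemma mass_ge A s : finite_mass A -> packing A s -> weight s <= mass A.
Proof. by move=> fA sA; apply: ub_le_sup => //; exists s. Qed.

Lemma mass_le A (c : R) : (forall s, packing A s -> weight s <= c) -> mass A <= c.
Proof.
move=> Ac; apply: ge_sup; last by move=> _ [s sA <-]; exact: Ac.
by exists (weight [::]), [::] => //; exact: packing0.
Qed.

Lemma mass_ge0 A : finite_mass A -> 0 <= mass A.
Proof.
move=> fA; apply: le_trans (mass_ge fA (packing0 A)).
by rewrite /weight big_nil.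
Qed.

Lemma packing_cat A B s s' : A `&` B = set0 -> packing A s -> packing B s' ->
  packing (A `|` B) (s ++ s').
Proof.
move=> AB0 [us sA ds] [us' sB ds'].
have AB x : A x -> B x -> False.
  by move=> Ax Bx; have : (A `&` B) x by []; rewrite AB0.
split.
- rewrite cat_uniq us us' /= andbT; apply/hasPn => p ps'.
  by apply/negP => ps; apply: (AB p.2); [exact: sA ps _ (pball_center p)|
    exact: sB ps' _ (pball_center p)].
- move=> p; rewrite mem_cat => /orP[/sA pA|/sB pB] x px; first by left; exact: pA.
  by right; exact: pB.
- move=> p q; rewrite !mem_cat => /orP[ps|ps] /orP[qs|qs].
  + exact: ds.
  + move=> _; rewrite -subset0 => x [px qx].
    by apply: (AB x); [exact: sA px|exact: sB qx].
  + move=> _; rewrite -subset0 => x [px qx].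
    by apply: (AB x); [exact: sA qx|exact: sB px].
  + exact: ds'.
Qed.

(** Packings of two disjoint sets concatenate to a packing of the union, and their weights add
    up. *)
Lemma massU A B C : A `&` B = set0 -> A `|` B `<=` C -> finite_mass C ->
  mass A + mass B <= mass C.
Proof.
move=> AB0 ABC fC.
have fA : finite_mass A by apply: finite_massS fC => x ?; apply: ABC; left.
have fB : finite_mass B by apply: finite_massS fC => x ?; apply: ABC; right.
rewrite /mass -sup_sumE; [|exact: has_sup_mass..].
apply: ge_sup.
  by exists (weight [::] + weight [::]), (weight [::]);
    [exists [::]|exists (weight [::]); [exists [::]|]] => //; exact: packing0.
move=> _ [_ [s sA <-] [_ [s' sB <-] <-]].
rewrite /weight -big_cat/=; apply: mass_ge => //.
exact: packingS ABC (packing_cat AB0 sA sB).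
Qed.

Lemma mass_sum (I : eqType) (l : seq I) (S : I -> set X) A : finite_mass A ->
  uniq l -> (forall i, i \in l -> S i `<=` A) ->
  (forall i j, i \in l -> j \in l -> i != j -> S i `&` S j = set0) ->
  \sum_(i <- l) mass (S i) <= mass A.
Proof.
elim: l A => [|i l IHl] A fA ul lA ld; first by rewrite big_nil mass_ge0.
rewrite big_cons; move: ul => /= /andP[il ul].
pose U := [set x | exists2 j, j \in l & S j x].
have UA : U `<=` A by move=> x [j jl]; apply: lA; rewrite inE jl orbT.
apply: (@le_trans _ _ (mass (S i) + mass U)).
  rewrite lerD2l; apply: IHl => //.
  - exact: finite_massS fA.
  - by move=> j jl x Sx; exists j.
  - by move=> j k jl kl; apply: ld; rewrite inE ?jl ?kl orbT.
apply: massU => //.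
- rewrite -subset0 => x [ix [j jl jx]].
  have := ld i j; rewrite !inE eqxx jl orbT => /(_ isT isT).
  have -> : i != j by apply: contraNneq il => ->.
  by move=> /(_ isT) E; have : (S i `&` S j) x by []; rewrite E.
- by move=> x [|/UA//]; apply: lA; rewrite inE eqxx.
Qed.

Lemma exists_scale (rho : R) : 0 < rho -> rho <= 1 ->
  exists k, 2^-1 ^+ k <= rho < 2 * 2^-1 ^+ k.
Proof.
move=> rho0 rho1.
have ex : exists k, (2^-1 : R) ^+ k <= rho.
  by apply: exists_expr_le => //; rewrite ?invr_gt0// invf_lt1 ?ltr1n.
case: (ex_minnP ex) => -[|k] hk kmin.
  by exists 0; rewrite hk expr0 mulr1 (le_lt_trans rho1)// ltr1n.
exists k.+1; rewrite hk exprS mulrA divff// mul1r ltNge.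
by apply/negP => /kmin; rewrite ltnn.
Qed.

Lemma mass_cball_ge x (rho : R) : 0 <= t -> 0 < rho -> rho <= 1 ->
  finite_mass (cball x rho) -> (rho / 2) `^ t <= mass (cball x rho).
Proof.
move=> t0 rho0 rho1 fx; have [k /andP[kr rk]] := exists_scale rho0 rho1.
apply: (@le_trans _ _ (weight [:: (k, x)])).
  rewrite /weight big_seq1 ge0_ler_powR// ?nnegrE ?divr_ge0 ?exprn_ge0 ?invr_ge0//.
    exact: ltW.
  by rewrite /= ler_pdivrMr// mulrC ltW.
apply: mass_ge => //; split=> //.
- by move=> p; rewrite inE => /eqP -> y /= xy; apply: le_trans xy kr.
- by move=> p q; rewrite !inE => /eqP -> /eqP ->; rewrite eqxx.
Qed.

(** Centres of disjoint balls of radius 2^-k are more than 2^-k apart, since otherwise one centre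
    would lie in the other ball. *)
Lemma size_level_covering A s k : packing A s ->
  (((size [seq p <- s | p.1 == k])%:R)%:E <= covering_number (2^-1 ^+ k : R) A)%E.
Proof.
move=> [us sA ds]; rewrite -(size_map snd).
apply: size_separated_covering; last first.
  move=> x /mapP[p]; rewrite mem_filter => /andP[_ ps ->].
  exact: sA (pball_center p).
rewrite pairwise_map; set l := [seq _ <- _ | _].
have : pairwise [rel x y | x != y] l by rewrite -uniq_pairwise filter_uniq.
apply: (@sub_in_pairwise _ (mem l)); last by apply/allP.
move=> p q; rewrite !mem_filter => /andP[/eqP pk ps] /andP[/eqP qk qs] /= pq.
rewrite ltNge; apply/negP => le; have : (pball p `&` pball q) q.2.
  by split; [rewrite /pball/cball/= pk|exact: pball_center].
by rewrite (ds p q).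
Qed.

(** Level k holds at most C (Q / 2^-k)^t' balls of weight 2^(-kt), hence contributes at most C Q^t'
    2^(-k(t - t')). Levels with 2^-k >= Q are empty, so a geometric series starting below Q^(t - t')
    remains. *)
Lemma weight_le A (Q C t' : R) s : 0 < Q -> 0 <= C -> t' < t ->
  (forall p, pball p `<=` A -> 2^-1 ^+ p.1 < Q) ->
  (forall k, 2^-1 ^+ k < Q ->
    (covering_number (2^-1 ^+ k : R) A <= (C * (Q / 2^-1 ^+ k) `^ t')%:E)%E) ->
  packing A s -> weight s <= C / (1 - 2^-1 `^ (t - t')) * Q `^ t.
Proof.
move=> Q0 C0 tt' AQ Acov sA.
pose a k : R := 2^-1 ^+ k; have a0 k : 0 < a k by rewrite exprn_gt0 ?invr_gt0.
pose d := t - t'; have d0 : 0 < d by rewrite subr_gt0.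
(* The term 2^(-kd) is its difference with the next one divided by 1 - 2^-d, so the series
   telescopes. The cap Q^d bounds the telescoped sum wherever the first occupied level is. *)
pose v k := Num.min (a k `^ d) (Q `^ d).
have h1 : 0 < 1 - 2^-1 `^ d :> R by exact: half_powR_lt1.
have aS k : a k.+1 `^ d = 2^-1 `^ d * a k `^ d.
  by rewrite /a exprS powRM ?exprn_ge0 ?invr_ge0.
have ale k : a k.+1 `^ d <= a k `^ d.
  by rewrite aS ler_piMl ?powR_ge0//; move: h1; rewrite subr_gt0 => /ltW.
pose N := (\max_(p <- s) p.1).+1.
have -> : weight s = \sum_(0 <= k < N) a k `^ t *+ size [seq p <- s | p.1 == k].
  transitivity (\sum_(p <- s) \sum_(0 <= k < N | k == p.1) a k `^ t).
    rewrite /weight big_seq [RHS]big_seq; apply: eq_bigr => p ps.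
    by rewrite big_nat1_eq /= ltnS (@leq_bigmax_seq _ s xpredT (fun p => p.1) p).
  rewrite (eq_bigr _ (fun _ _ => big_mkcond _ _)) exchange_big/=.
  apply: eq_bigr => k _; rewrite -big_mkcond big_const_seq iter_addr_0 size_filter.
  by congr (_ *+ _); apply: eq_count => p; rewrite eq_sym.
have step k : a k `^ t *+ size [seq p <- s | p.1 == k] <=
    C / (1 - 2^-1 `^ d) * Q `^ t' * (v k - v k.+1).
  (* An empty level is harmless because [v] is nonincreasing; a nonempty one has radius below [Q],
     where the cap in [v] is inactive. *)
  case E : [seq p <- s | p.1 == k] => [|p l].
    rewrite mulr0n !mulr_ge0 ?powR_ge0 ?divr_ge0 ?invr_ge0 ?(ltW h1)//.
    by rewrite subr_ge0 /v le_min !ge_min ale lexx orbT.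
  have [ps /eqP pk] : p \in s /\ p.1 == k.
    by apply/andP; rewrite andbC -(mem_filter (fun p => p.1 == k)) E mem_head.
  have akQ : a k < Q by have [_ sA' _] := sA; rewrite -pk AQ//; exact: sA'.
  have := le_trans (size_level_covering k sA) (Acov k akQ).
  rewrite lee_fin E => sz.
  have vle j : a j < Q -> v j = a j `^ d.
    move=> ajQ; apply/min_idPl; rewrite ge0_ler_powR ?nnegrE ?ltW//.
  rewrite !vle//; last first.
    apply: le_lt_trans akQ; rewrite /a exprS ler_piMl ?exprn_ge0 ?invr_ge0//.
    by rewrite invf_le1 ?ler1n.
  have -> : C / (1 - 2^-1 `^ d) * Q `^ t' * (a k `^ d - a k.+1 `^ d) =
      C * Q `^ t' * a k `^ d.
    have /gt_eqF/negbT := h1; rewrite aS; set b := _ `^ d => h1n.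
    by field.
  rewrite -mulr_natl (le_trans (ler_wpM2r (powR_ge0 _ _) sz))//.
  have -> : a k `^ t = a k `^ t' * a k `^ d.
    by rewrite -powRD ?(gt_eqF (a0 k)) ?implybT// /d addrC subrK.
  have -> : (Q / 2^-1 ^+ k) `^ t' = Q `^ t' / a k `^ t'.
    by rewrite powRM ?invr_ge0 ?(ltW Q0) ?(ltW (a0 k))// powRV// ltW.
  suff -> : C * (Q `^ t' / a k `^ t') * (a k `^ t' * a k `^ d) =
    C * Q `^ t' * a k `^ d by [].
 have akt : a k `^ t' != 0 by rewrite gt_eqF// powR_gt0.
  by field.
apply: le_trans (ler_sum _ (fun k _ => step k)) _.
rewrite -mulr_sumr.
rewrite (eq_bigr (fun k => - (v k.+1 - v k))); last by move=> k _; rewrite opprB.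
rewrite sumrN telescope_sumr// opprB -!mulrA ler_wpM2l// ler_wpM2l ?invr_ge0 ?(ltW h1)//.
have -> : Q `^ t = Q `^ t' * Q `^ d.
  by rewrite -powRD ?(gt_eqF Q0) ?implybT// /d addrC subrK.
rewrite ler_wpM2l ?powR_ge0// lerBlDr.
have vN : 0 <= v N by rewrite le_min !powR_ge0.
by rewrite ler_wpDr// ge_min lexx orbT.
Qed.

End mass.

(** * Alice's answer *)

Lemma pairwise_in (T : eqType) (e : rel T) (s : seq T) : symmetric e ->
  pairwise e s -> forall x y, x \in s -> y \in s -> x != y -> e x y.
Proof.
move=> esym es x y xs ys xy; have /pairwiseP-/(_ x) es' := es.
have [ix iy] : (index x s < size s)%N /\ (index y s < size s)%N.
  by rewrite !index_mem.
case: (ltngtP (index x s) (index y s)) => [lt|lt|].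
- by have := es' _ _ ix iy lt; rewrite !nth_index.
- by have := es' _ _ iy ix lt; rewrite !nth_index// esym.
- by move=> /(congr1 (nth x s)); rewrite !nth_index// => /eqP; rewrite (negPf xy).
Qed.

Section perfect.
Context {R : realType} {X : completeMetricType R}.
Hypothesis perfectX : uniformly_perfect X.

Lemma uniformly_perfect_covering : exists s C : R, [/\ 0 < s, 0 < C &
  forall r q (x : X), 0 < r -> r < q -> q <= 1 ->
    ((C * (q / r) `^ s)%:E <= covering_number r (cball x q))%E].
Proof.
have /ereal_sup_gt[_ [s [s0 [C C0 H]] <-] s0'] := perfectX.
exists s, C; split=> // r q x r0 rq q1.
have := H r q x r0 rq; rewrite setIT; apply=> //.
by rewrite le_max lee_fin q1 orbT.
Qed.

(** If the annulus were empty, [cball x r] would equal a much smaller ball and be covered by one set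
    of diameter [l * r], against the lower bound C l^-s > 1. *)
Lemma uniformly_perfect_annulus : exists kappa : R, 0 < kappa < 1 /\
  forall (x : X) r, 0 < r -> r <= 1 ->
    exists z, kappa * r < mdist x z /\ mdist x z <= r.
Proof.
have [s [C [s0 C0 H]]] := uniformly_perfect_covering.
(* The second entry gives l^s <= C / 2 < C; the first keeps [l * r] below [r]. *)
pose l : R := Num.min 2^-1 ((C / 2) `^ s^-1).
have l0 : 0 < l by rewrite lt_min invr_gt0 ltr0n powR_gt0// divr_gt0.
have l2 : l <= 2^-1 by rewrite ge_min lexx.
have ls : l `^ s < C.
  apply: (@le_lt_trans _ _ (((C / 2) `^ s^-1) `^ s)).
    by rewrite ge0_ler_powR ?nnegrE ?powR_ge0 ?(ltW s0) ?(ltW l0)// ge_min lexx orbT.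
  by rewrite -powRrM mulVf ?gt_eqF// powRr1; lra.
exists (l / 4); split; first by lra.
move=> x r r0 r1; apply: contrapT => Hz.
have /= := H (l * r) r x (mulr_gt0 l0 r0).
have lr : l * r < r by rewrite gtr_pMl//; lra.
move=> /(_ lr r1); apply/negP; rewrite -ltNge.
apply: (@le_lt_trans _ _ 1%E).
  apply: (@covering_number_le _ _ _ _ 1).
  apply: (@coverable_cballs _ _ _ (l / 4 * r) _ [:: x]).
  - by rewrite mulr_gt0// divr_gt0.
  - by lra.
  move=> z xz; exists x; first by rewrite mem_head.
  by rewrite /cball/= leNgt; apply/negP => h; apply: Hz; exists z.
rewrite lte_fin invfM [r * _]mulrCA divff ?gt_eqF// mulr1.
by rewrite powRV ?(ltW l0)// ltr_pdivlMr ?mul1r// powR_gt0.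
Qed.

End perfect.

Section response.
Context {R : realType} {X : completeMetricType R}.
Variables (t alpha : R).

(* The pairs are (f, g): f runs through a net of K, g is the answer near f. *)
Definition response (K : set X) (r : R) (s : seq (X * X)) : Prop := [/\
  forall p, p \in s -> K p.1,
  forall x, K x -> exists2 p, p \in s & mdist x p.1 <= r / 2,
  pairwise (fun p q => r / 2 < mdist p.1 q.1) s,
  forall p, p \in s -> mdist p.1 p.2 <= r / 8 &
  r <= 1 -> forall p, p \in s ->
    mass t (cball p.2 (alpha * r)) <= mass t (cball p.1 (r / 4)) / 2].

(** The annulus at scale r/8 around f gives z more than kappa r/8 away, so the balls of radius kappa
    r/16 at f and z are disjoint. Both lie in [cball f (r / 4)], and by superadditivity one has at
    most half its mass. *)
Lemma exists_response kappa (K : compacts X) (r : R) :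
  (forall x r, finite_mass t (cball x r : set X)) ->
  0 < kappa < 1 -> alpha = kappa / 16 ->
  (forall (x : X) r, 0 < r -> r <= 1 ->
    exists z, kappa * r < mdist x z /\ mdist x z <= r) ->
  0 < r -> exists s, response K r s.
Proof.
move=> fin /andP[k0 k1] aE annulus r0.
have [|n Kn] := @compact_coverable _ _ K (r / 2) _ (@cset_compact _ _ K).
  by rewrite divr_gt0.
have [|s [sep sK Ks]] := maximal_separated _ Kn; first by rewrite ltW ?divr_gt0.
have near (f : X) : exists g, mdist f g <= r / 8 /\ (r <= 1 ->
    mass t (cball g (kappa / 16 * r)) <= mass t (cball f (r / 4)) / 2).
  (* For r > 1 the mass clause is void and f itself serves as the answer. *)
  have [r1|r1] := leP r 1; last first.
    by exists f; rewrite mdistxx; split=> //; rewrite ltW// divr_gt0.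
  have [||z [fz zf]] := annulus f (r / 8); [lra..|].
  have : mass t (cball f (kappa / 16 * r)) + mass t (cball z (kappa / 16 * r))
      <= mass t (cball f (r / 4)).
    apply: massU => //.
    - rewrite -subset0 => y [fy zy]; have := metric_triangle f y z.
      rewrite (metric_sym y z); move: fy zy fz; rewrite /cball/= => fy zy fz.
      by apply/negP; rewrite -ltNge; lra.
    - have kr : kappa * r < r by rewrite gtr_pMl.
      by move=> y []; apply: cball_sub; rewrite ?mdistxx; lra.
  have [le|lt] := leP (mass t (cball f (kappa / 16 * r))) (mass t (cball f (r / 4)) / 2).
    by exists f; rewrite mdistxx; split=> //; rewrite ltW// divr_gt0.
  by exists z; split=> // _; lra.
have [g gP] := choice near.
exists [seq (f, g f) | f <- s]; split.
- by move=> _ /mapP[f fs ->]; exact: sK.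
- by move=> x /Ks[f fs xf]; exists (f, g f) => //; apply/mapP; exists f.
- by rewrite pairwise_map.
- by move=> _ /mapP[f fs ->]; have [] := gP f.
- by move=> r1 _ /mapP[f fs ->]; rewrite aE; have [_ /(_ r1)] := gP f.
Qed.

Lemma response_disjoint (K : set X) (r : R) s : response K r s ->
  forall p q, p \in s -> q \in s -> p != q ->
  cball p.1 (r / 4) `&` cball q.1 (r / 4) = set0.
Proof.
move=> [_ _ sep _ _] p q ps qs pq; rewrite -subset0 => x [px qx].
have esym : symmetric (fun p q : X * X => r / 2 < mdist p.1 q.1).
  by move=> p' q' /=; rewrite metric_sym.
have := pairwise_in esym sep ps qs pq; apply/negP; rewrite -leNgt.
apply: le_trans (metric_triangle p.1 x q.1) _; rewrite (metric_sym x).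
by move: px qx; rewrite /cball/=; lra.
Qed.

Lemma response_uniq (K : set X) (r : R) s : 0 < r -> response K r s -> uniq s.
Proof.
move=> r0 [_ _ sep _ _]; apply: pairwise_uniq sep => p.
by rewrite /= mdistxx ltNge ltW// divr_gt0.
Qed.

End response.

(** * Completeness of the hyperspace *)

Section hausdorff.
Context {R : realType} {X : metricType R}.
Implicit Types K L : compacts X.

(** Compactness turns the infimum into a minimum, so that Hausdorff closeness yields nearby points
    within the closed bound, without loss. *)
Lemma dist_to_attained (x : X) L : exists2 a, cset L a & mdist x a = dist_to x L.
Proof.
have [c Lc cM] := @compact_EVT_min X R (mdist x) (cset L) (cset_neq0 L)
  (cset_compact L) (continuous_subspaceT (@mdist_continuous R X x)).
rewrite inE in Lc; exists c => //; apply/eqP; rewrite eq_le dist_to_le// andbT.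
apply: lb_le_inf; first by case: (has_inf_dist_to x (cset_neq0 L)).
by move=> _ [b Lb <-]; apply: cM; rewrite inE.
Qed.

Lemma mdist_compactsE K L : mdist K L = hausdorff_dist K L.
Proof. by []. Qed.

Lemma hausdorff_near K L (e : R) a : mdist K L <= e -> cset K a ->
  exists2 b, cset L b & mdist a b <= e.
Proof.
rewrite mdist_compactsE /hausdorff_dist ge_max => /andP[KL _] Ka.
have [b Lb ab] := dist_to_attained a L; exists b => //.
by rewrite ab (le_trans (excess_ge L Ka)).
Qed.

Lemma hausdorff_le K L (e : R) :
  (forall a, cset K a -> exists2 b, cset L b & mdist a b <= e) ->
  (forall b, cset L b -> exists2 a, cset K a & mdist b a <= e) ->
  mdist K L <= e.
Proof.
move=> KL LK; rewrite mdist_compactsE /hausdorff_dist ge_max; apply/andP; split.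
  by apply: excess_le => a /KL[b Lb]; apply: le_trans; exact: dist_to_le.
by apply: excess_le => b /LK[a Ka]; apply: le_trans; exact: dist_to_le.
Qed.

End hausdorff.

Section complete.
Context {R : realType} {X : completeMetricType R}.

(** An ultrafilter on [A] contains a member of every finite cover, hence arbitrarily small sets; it
    is Cauchy, and its limit lies in the closed set [A]. *)
Lemma totally_bounded_compact (A : set X) : closed A ->
  (forall e : R, 0 < e -> exists n, coverable e A n) -> compact A.
Proof.
move=> clA tbA; rewrite compact_ultra => F UF FA.
have PF : ProperFilter F by exact: ultra_proper.
have FF : Filter F by exact: filter_filter.
have /cauchy_cvg Fcvg : cauchy F.
  apply: cauchy_exP => e e0.
  have [n [U [Uo AU]]] := tbA (e / 2) (divr_gt0 e0 (ltr0Sn _ _)).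
  have [[i FU]|noU] := pselect (exists i, F (U i)).
    have [x Ux] := filter_ex FU; exists x; apply: filterS FU => y Uy.
    rewrite ballEmdist/=.
    by apply: le_lt_trans (diam_mdist (Uo i).2 Ux Uy) _; lra.
  have : F (fun x => forall i, ~ U i x).
    apply: filter_forall => i.
    by have [|//] := in_ultra_setVsetC (U i) UF => FU; case: noU; exists i.
  move=> FN; have [x [Ax Nx]] := filter_ex (filterI FA FN).
  by have [i _ Ui] := AU x Ax; case: (Nx i).
exists (lim F); split=> //.
have := clA; rewrite closedE; apply => /= nA.
have : F (~` A) by exact: Fcvg nA.
by move=> /(filterI FA); rewrite setICr; exact: filter_not_empty.
Qed.

(** The inequality telescopes over k steps, so [r] is an explicit Cauchy rate that survives in the
    limit. *)
Lemma cauchy_seq_limit (u : nat -> X) (r : nat -> R) :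
  (forall n, 0 <= r n) -> (forall e : R, 0 < e -> exists n, r n <= e) ->
  (forall n, mdist (u n) (u n.+1) + r n.+1 <= r n) ->
  exists x, forall n, mdist (u n) x <= r n.
Proof.
move=> nonneg r0 ur.
have urk n k : mdist (u n) (u (n + k)%N) + r (n + k)%N <= r n.
  elim: k => [|k IHk]; first by rewrite addn0 mdistxx add0r.
  rewrite addnS; have := ur (n + k)%N.
  have := metric_triangle (u n) (u (n + k)%N) (u (n + k).+1); lra.
have /cauchy_cvg ucvg : cauchy (u @ \oo).
  apply: cauchy_exP => e e0.
  have [n rn] := r0 (e / 2) (divr_gt0 e0 (ltr0Sn _ _)).
  exists (u n), n => // m /= /subnKC <-; rewrite ballEmdist/=.
  have := urk n (m - n)%N; have := nonneg (n + (m - n))%N; lra.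
exists (lim (u @ \oo)) => n; apply/ler_addgt0Pr => e e0.
have /metricType_numDomainType.cvgrPdist_lt/(_ e e0)[N _ /(_ (n + N)%N)/=] := ucvg.
rewrite leq_addl => /(_ isT) h.
have := metric_triangle (u n) (u (n + N)%N) (lim (u @ \oo)).
rewrite (metric_sym (u (n + N)%N)).
have := urk n N; have := nonneg (n + N)%N; lra.
Qed.

(** This is the outcome of the game. It consists of the points within [r n] of [K n] for all n; each
    point of [K n] is followed through the later sets by nearby points, whose limit lies in it. *)
Lemma compacts_nested (K : nat -> compacts X) (r : nat -> R) :
  (forall n, 0 <= r n) -> (forall e : R, 0 < e -> exists n, r n <= e) ->
  (forall n, mdist (K n) (K n.+1) + r n.+1 <= r n) ->
  exists Z : compacts X, \bigcap_n cball (K n) (r n) = [set Z].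
Proof.
move=> rge0 r0 Kr.
have dec n m : mdist (K n) (K (n + m)%N) + r (n + m)%N <= r n.
  elim: m => [|m IHm]; first by rewrite addn0 mdistxx add0r.
  rewrite addnS; have := Kr (n + m)%N.
  have := metric_triangle (K n) (K (n + m)%N) (K (n + m).+1); lra.
pose Z := [set b | forall n, dist_to b (K n) <= r n].
have Zlim n a : cset (K n) a -> exists2 b, Z b & mdist a b <= r n.
  move=> Ka.
  (* Outside [K k] the value is arbitrary, so that [choice] gives a total function. *)
  have next k x : exists y, cset (K k) x ->
      cset (K k.+1) y /\ mdist x y <= mdist (K k) (K k.+1).
    have [Kx|] := pselect (cset (K k) x); last by exists x.
    by have [y Ky xy] := hausdorff_near (lexx (mdist (K k) (K k.+1))) Kx; exists y.
  pose f k := projT1 (choice (next k)).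
  have fP k x := projT2 (choice (next k)) x.
  pose u := fix u k := if k is k'.+1 then f (n + k')%N (u k') else a.
  have uK k : cset (K (n + k)%N) (u k).
    elim: k => [|k IHk]; first by rewrite addn0.
    by rewrite addnS /=; have [] := fP (n + k)%N (u k) IHk.
  have [|||b ub] := @cauchy_seq_limit u (fun k => r (n + k)%N).
  - by move=> k; exact: rge0.
  - move=> e /r0[m rm]; exists m; apply: le_trans rm.
    have := dec m n; rewrite addnC; have := mdist_ge0 (K m) (K (n + m)%N); lra.
  - move=> k; have [_] := fP (n + k)%N (u k) (uK k).
    by rewrite addnS /=; have := Kr (n + k)%N; lra.
  exists b; last by have := ub 0%N; rewrite addn0.
  move=> m; have [nm|/ltnW mn] := leqP n m.
    apply: (@le_trans _ _ (mdist b (u (m - n)%N))).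
      by apply: (@dist_to_le _ _ b (K m)); have := uK (m - n)%N; rewrite subnKC.
    by rewrite metric_sym; have := ub (m - n)%N; rewrite subnKC.
  (* For earlier sets, the limit is within [r n] of a, and a is within [mdist (K m) (K n)] of [K m];
     by [dec] the sum is at most [r m]. *)
  have := dec m (n - m)%N; rewrite subnKC// => mnr.
  have [|c Kc ac] := @hausdorff_near _ _ (K n) (K m) (mdist (K m) (K n)) a _ Ka.
    by rewrite metric_sym.
  apply: le_trans (dist_to_le b Kc) _; apply: le_trans (metric_triangle b a c) _.
  by have := ub 0%N; rewrite addn0 metric_sym /=; lra.
have Znear n b : Z b -> exists2 a, cset (K n) a & mdist b a <= r n.
  move=> Zb; have [a Ka ba] := dist_to_attained b (K n); exists a => //.
  by rewrite ba; exact: Zb.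
have clZ : closed Z.
  move=> b clb n; apply/ler_addgt0Pr => e e0.
  have [|c [Zc]] := clb (ball b e).
    by apply/nbhs_ballP; exists e.
  rewrite ballEmdist/= => bc; have [a Ka ca] := Znear n c Zc.
  apply: le_trans (dist_to_le b Ka) _; have := metric_triangle b c a; lra.
have tbZ (e : R) : 0 < e -> exists m, coverable e Z m.
  move=> e0; have e8 : 0 < e / 8 by rewrite divr_gt0.
  have [n rn] := r0 (e / 8) e8.
  have [m Km] := compact_coverable e8 (@cset_compact _ _ (K n)).
  have [s [_ _ sK]] := maximal_separated (ltW e8) Km.
  exists (size s); apply: (@coverable_cballs _ _ _ (e / 4)); [lra..|].
  move=> b /(Znear n)[a Ka ba]; have [y ys ay] := sK a Ka.
  exists y => //; rewrite /cball/= metric_sym.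
  have := metric_triangle b a y; lra.
have Z0 : Z !=set0.
  by have [a Ka] := cset_neq0 (K 0%N); have [b Zb _] := Zlim 0%N a Ka; exists b.
pose ZK := Compacts (totally_bounded_compact clZ tbZ) Z0.
have ZKn n : mdist (K n) ZK <= r n.
  by apply: hausdorff_le => [a|b Zb]; [exact: Zlim|exact: Znear].
(* Uniqueness: two points of all the balls are at distance at most [2 * r n] for every n. *)
exists ZK; apply/seteqP; split=> [L KL|_ -> n _]; last exact: ZKn.
apply: mdist_positivity; apply/eqP; rewrite eq_le mdist_ge0 andbT.
apply/ler_addgt0Pr => e e0; rewrite add0r.
have [n rn] := r0 (e / 2) (divr_gt0 e0 (ltr0Sn _ _)).
apply: le_trans (metric_triangle L (K n) ZK) _.
by have := KL n I; rewrite /cball/= metric_sym; have := ZKn n; lra.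
Qed.

End complete.

(** * Covering numbers of the outcome *)

Section counting.
Context {R : realType} {X : completeMetricType R}.
Variables (t s alpha beta r0 : R).
Hypotheses (t0 : 0 <= t) (s0 : 0 <= s) (alpha0 : 0 < alpha)
  (alpha16 : alpha <= 16^-1) (beta0 : 0 < beta) (beta1 : beta < 1) (r00 : 0 < r0).
(** Its n-th power turns the ball count 2^-n (alpha beta)^(-nt) into (alpha beta)^(-ns); the factor
    2 stands for the halving of the mass in each round. *)
Hypothesis st : (alpha * beta) `^ s <= 2 * (alpha * beta) `^ t.
Hypothesis fin : forall (x : X) (r : R), finite_mass t (cball x r).
Variables (K Y : nat -> compacts X) (S : nat -> seq (X * X)) (Z : compacts X).
Let r n : R := (alpha * beta) ^+ n * r0.
Hypothesis SK : forall n, response t alpha (K n) (r n) (S n).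
Hypothesis YS : forall n y, cset (Y n) y -> exists2 p, p \in S n & y = p.2.
Hypothesis bob : forall n, bob_legal alpha beta (r n) (Y n) (K n.+1).
Hypothesis KZ : forall n, mdist (K n) Z <= r n.

Let gamma := alpha * beta.

Let gamma0 : 0 < gamma. Proof. exact: mulr_gt0. Qed.

Let gamma1 : gamma < 1.
Proof.
apply: le_lt_trans beta1; rewrite /gamma ler_piMl ?(ltW beta0)//.
by move: alpha16; lra.
Qed.

Let r_gt0 n : 0 < r n.
Proof. by rewrite mulr_gt0// exprn_gt0. Qed.

Let rS n : r n.+1 = gamma * r n.
Proof. by rewrite /r exprS mulrA. Qed.

Let rD m n : r (m + n)%N = gamma ^+ n * r m.
Proof. by rewrite /r addnC exprD mulrA. Qed.

Let r_le m n : r (m + n)%N <= r m.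
Proof.
by rewrite rD ler_piMl ?(ltW (r_gt0 m))// exprn_ile1 ?(ltW gamma1) ?(ltW gamma0).
Qed.

(** Bob's legality leaves [mdist (Y n) (K n.+1) <= alpha * r n - r n.+1], and [Z] is within [r n.+1]
    of [K n.+1]. *)
Let Z_near n x : cset Z x -> exists2 p, p \in S n & cball p.2 (alpha * r n) x.
Proof.
move=> Zx; have YZ : mdist Z (Y n) <= alpha * r n.
  rewrite metric_sym; apply: le_trans (metric_triangle (Y n) (K n.+1) Z) _.
  by have := bob n; have := KZ n.+1; rewrite /bob_legal rS -/gamma; lra.
have [y /YS[p pS ->] xy] := hausdorff_near YZ Zx.
by exists p => //; rewrite /cball/= metric_sym.
Qed.

Let parent n p : p \in S n.+1 -> exists2 q, q \in S n &
  cball p.1 (r n.+1 / 4) `<=` cball q.2 (alpha * r n).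
Proof.
move=> pS; have [SKp _ _ _ _] := SK n.+1.
have KY : mdist (K n.+1) (Y n) <= alpha * r n - r n.+1.
  by rewrite metric_sym; have := bob n; rewrite /bob_legal rS -/gamma; lra.
have [y /YS[q qS ->] pq] := hausdorff_near KY (SKp p pS).
exists q => //; apply: cball_sub; rewrite metric_sym.
have := r_gt0 n.+1; lra.
Qed.

Let answer_sub n p : p \in S n ->
  cball p.2 (alpha * r n) `<=` cball p.1 (r n / 4).
Proof.
have [_ _ _ Sp _] := SK n; move=> /Sp pp; apply: cball_sub.
have := ler_wpM2r (ltW (r_gt0 n)) alpha16; have := r_gt0 n; lra.
Qed.

(** The set [B] localises the count: the whole space for the global estimate, a ball for the Assouad
    dimension. *)
Let meets (B : set X) n (p : X * X) : bool :=
  `[< cball p.2 (alpha * r n) `&` B !=set0 >].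

Let total B n := \sum_(p <- S n | meets B n p) mass t (cball p.2 (alpha * r n)).

(** An answer ball has at most half the mass of its net ball. The net balls of round n + 1 are
    disjoint and lie in answer balls of round n that again meet [B], so superadditivity bounds their
    masses. *)
Let total_half B n : r n.+1 <= 1 -> total B n.+1 <= total B n / 2.
Proof.
move=> rn1; rewrite /total.
pose sub (q p : X * X) :=
  `[< cball p.1 (r n.+1 / 4) `<=` cball q.2 (alpha * r n) >].
have [_ _ _ _ /(_ rn1) half] := SK n.+1.
(* Each net ball is charged to every answer ball containing it, at least one by [parent]; after
   exchanging the sums, [mass_sum] applies inside each answer ball. *)
apply: (@le_trans _ _ ((\sum_(p <- S n.+1 | meets B n.+1 p)
    \sum_(q <- S n | meets B n q && sub q p) mass t (cball p.1 (r n.+1 / 4))) / 2)).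
  rewrite mulr_suml big_seq_cond [leRHS]big_seq_cond; apply: ler_sum => p.
  move=> /andP[pS /asboolP[y [py By]]]; apply: le_trans (half p pS) _.
  rewrite ler_wpM2r ?invr_ge0//.
  have [q qS pq] := parent pS.
  rewrite (big_rem q)//= ifT; last first.
    apply/andP; split; apply/asboolP => //; exists y; split=> //.
    exact/pq/answer_sub.
  by rewrite lerDl sumr_ge0// => ? _; exact: mass_ge0.
rewrite ler_wpM2r ?invr_ge0//.
rewrite (exchange_big_dep (meets B n))/=; last by move=> p q _ /andP[].
rewrite [leLHS]big_seq_cond [leRHS]big_seq_cond.
apply: ler_sum => q /andP[qS qB]; rewrite -big_filter.
apply: mass_sum => //.
- by rewrite filter_uniq// (response_uniq (r_gt0 _) (SK _)).
- by move=> p; rewrite mem_filter => /andP[/andP[_ /andP[_ /asboolP]]].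
- move=> p p'; rewrite !mem_filter => /andP[_ pS] /andP[_ p'S] pp'.
  exact: response_disjoint (SK n.+1) _ _ pS p'S pp'.
Qed.

Let total_le B m n : r m <= 1 -> total B (m + n)%N <= 2^-1 ^+ n * total B m.
Proof.
move=> rm1; elim: n => [|n IHn]; first by rewrite addn0 expr0 mul1r.
rewrite addnS; apply: le_trans (total_half _ _) _.
  by rewrite -addnS (le_trans (r_le _ _)).
by rewrite exprSr -mulrA [_ * total _ _]mulrC mulrA ler_wpM2r ?invr_ge0.
Qed.

Let count_le B n : alpha * r n <= 1 ->
  (count (meets B n) (S n))%:R * (alpha * r n / 2) `^ t <= total B n.
Proof.
move=> an1; rewrite mulr_natl -iter_addr_0 -big_const_seq; apply: ler_sum => p _.
by apply: mass_cball_ge => //; rewrite mulr_gt0.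
Qed.

Let covering_count B n : (covering_number (4 * (alpha * r n)) (B `&` Z) <=
  ((count (meets B n) (S n))%:R)%:E)%E.
Proof.
apply: covering_number_le.
have -> : count (meets B n) (S n) = size [seq p.2 | p <- S n & meets B n p].
  by rewrite size_map size_filter.
apply: (@coverable_cballs _ _ _ (alpha * r n)) => //; first by rewrite mulr_gt0.
move=> x [Bx /(Z_near n)[p pS px]]; exists p.2 => //; apply: map_f.
by rewrite mem_filter pS andbT; apply/asboolP; exists x.
Qed.

(** At the first round n after m with 4 alpha r_(m+n) <= rho, the answer balls meeting [B] cover.
    Each has mass at least (alpha r_(m+n) / 2)^t, while their total has been halved n times. *)
Let covering_total B m (c rho : R) : r m <= 1 -> 0 <= c -> total B m <= c * r m `^ t ->
  0 < rho -> (covering_number rho (B `&` Z) <=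
    (c * ((2 / alpha) `^ t * (4 / beta) `^ s) * Num.max 1 (r m / rho) `^ s)%:E)%E.
Proof.
move=> rm1 c0 Bm rho0.
have ex : exists n, 4 * (alpha * r (m + n)%N) <= rho.
  have a0 : 0 < 4 * alpha * r m by apply: mulr_gt0 => //; exact: mulr_gt0.
  have [n hn] := exists_expr_le gamma0 gamma1 (divr_gt0 rho0 a0).
  by exists n; move: hn; rewrite ler_pdivlMr// rD; lra.
case: (ex_minnP ex) => n nrho nmin.
apply: le_trans (covering_number_mono nrho (@subset_refl _ (B `&` Z))) _.
apply: le_trans (covering_count _ _) _; rewrite lee_fin.
have gn0 k : 0 < gamma ^+ k by exact: exprn_gt0.
(* For n > 0 round n - 1 is still too coarse, which gives the bound with r_m / rho; the entry 1 of
   the maximum covers n = 0. *)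
have gk : gamma ^- n <= 4 / beta * Num.max 1 (r m / rho).
  case: n nmin {nrho} => [|n] nmin.
    rewrite expr0 invr1 -[leLHS]mulr1 ler_pM// ?le_max ?lexx//.
    by rewrite ler_pdivlMr// mul1r; move: beta1; lra.
  have : ~~ (4 * (alpha * r (m + n)%N) <= rho).
    by apply/negP => /nmin; rewrite ltnn.
  rewrite -ltNge rD => lt.
  apply: (@le_trans _ _ (4 / beta * (r m / rho))); last first.
    by rewrite ler_wpM2l ?divr_ge0 ?(ltW beta0)// le_max lexx orbT.
  rewrite -[leLHS]mul1r ler_pdivrMr// exprSr.
  have -> : 4 / beta * (r m / rho) * (gamma ^+ n * gamma) =
      4 * (alpha * (gamma ^+ n * r m)) / rho.
    have bn : beta != 0 by rewrite gt_eqF.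
    by have rn : rho != 0 by [rewrite gt_eqF]; rewrite /gamma; field; rewrite bn rn.
  by rewrite ler_pdivlMr// mul1r ltW.
have gX u : (gamma ^+ n) `^ u = (gamma `^ u) ^+ n.
  rewrite -[gamma ^+ n]powR_mulrn ?(ltW gamma0)//.
  by rewrite -[RHS]powR_mulrn ?powR_ge0// -!powRrM mulrC.
have gs : (gamma `^ s) ^- n <= (4 / beta) `^ s * Num.max 1 (r m / rho) `^ s.
  rewrite -gX -powRV ?(ltW (gn0 _))// -powRM ?divr_ge0 ?(ltW beta0)//; last first.
    by rewrite le_max ler01.
  rewrite ge0_ler_powR ?nnegrE// ?invr_ge0 ?(ltW (gn0 _))//.
  by rewrite mulr_ge0 ?divr_ge0 ?(ltW beta0)// le_max ler01.
have arn : alpha * r (m + n)%N <= 1.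
  by have := r_le m n; have := ler_wpM2r (ltW (r_gt0 (m + n)%N)) alpha16; lra.
have pow2 : (2^-1 : R) ^+ n / (gamma `^ t) ^+ n <= (gamma `^ s) ^- n.
  rewrite exprVn -invfM -exprMn lef_pV2 ?posrE ?exprn_gt0 ?mulr_gt0 ?powR_gt0//.
  by rewrite lerXn2r ?nnegrE ?mulr_ge0 ?powR_ge0.
have := le_trans (count_le B arn) (le_trans (total_le B n rm1)
  (ler_wpM2l (exprn_ge0 n (ltac:(by rewrite invr_ge0) : 0 <= 2^-1 :> R)) Bm)).
have -> : (alpha * r (m + n)%N / 2) `^ t =
    (gamma `^ t) ^+ n * r m `^ t / (2 / alpha) `^ t.
  have -> : alpha * r (m + n)%N / 2 = gamma ^+ n * r m * (2 / alpha)^-1.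
    by rewrite rD invf_div; ring.
  move: (r m) (r_gt0 m) => M M0.
  rewrite powRM; last 2 first.
  - by rewrite mulr_ge0 ?(ltW M0) ?(ltW (gn0 n)).
  - by rewrite invr_ge0 divr_ge0 ?(ltW alpha0).
  by rewrite powRM ?(ltW M0) ?(ltW (gn0 n))// gX powRV// divr_ge0 ?(ltW alpha0).
set N : R := (count _ _)%:R; set P := (2 / alpha) `^ t.
set G := (gamma `^ t) ^+ n; set M := r m `^ t; set W := Num.max _ _ `^ s => cnt.
have P0 : 0 < P by rewrite powR_gt0// divr_gt0.
have G0 : 0 < G by rewrite exprn_gt0// powR_gt0.
have M0 : 0 < M by rewrite powR_gt0.
apply: (@le_trans _ _ (c * P * (2^-1 ^+ n / G))).
  have /ltW/ler_wpM2r/(_ _ _ cnt) : 0 < P / (G * M) by rewrite divr_gt0// mulr_gt0.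
  have [PN GN MN] : [/\ P != 0, G != 0 & M != 0] by rewrite !gt_eqF.
  have -> : N * (G * M / P) * (P / (G * M)) = N by field; rewrite PN GN MN.
  move: (2^-1 ^+ n) => E.
  by have -> : E * (c * M) * (P / (G * M)) = c * P * (E / G) by field; rewrite GN MN.
rewrite -!mulrA ler_wpM2l// ler_wpM2l ?(ltW P0)//.
exact: le_trans pow2 gs.
Qed.

Let covering_global m : r m <= 1 -> exists2 C : R, 0 < C &
  forall rho, 0 < rho ->
    (covering_number rho Z <= (C * Num.max 1 (r m / rho) `^ s)%:E)%E.
Proof.
move=> rm1; have M0 : 0 < r m `^ t by rewrite powR_gt0.
have T0 : 0 <= total setT m by rewrite sumr_ge0// => p _; exact: mass_ge0.
(* The added 1 makes the constant positive even if the total mass vanishes. *)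
exists ((total setT m + 1) / r m `^ t * ((2 / alpha) `^ t * (4 / beta) `^ s)).
  by rewrite !mulr_gt0 ?invr_gt0 ?powR_gt0 ?divr_gt0// ltr_wpDl.
move=> rho rho0; rewrite -[cset Z]setTI; apply: covering_total => //.
  by rewrite divr_ge0 ?(ltW M0) ?addr_ge0.
by rewrite divfK ?gt_eqF// lerDl.
Qed.

Let exists_round (e : R) : 0 < e -> exists m, r m <= e.
Proof.
move=> e0; have [n hn] := exists_expr_le gamma0 gamma1 (divr_gt0 e0 r00).
by exists n; rewrite /r -ler_pdivlMr.
Qed.

Lemma covering_outcome : exists C rho0 : R, [/\ 0 < C, 0 < rho0 &
  forall rho, 0 < rho ->
    (covering_number rho Z <= (C * Num.max 1 (rho0 / rho) `^ s)%:E)%E].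
Proof.
have [m rm] := exists_round ltr01; have [C C0 H] := covering_global rm.
by exists C, (r m); split.
Qed.

(** For q >= r_m the global estimate suffices. For smaller q the count starts at the round whose
    radius is comparable to q, where the mass near the ball is of order q^t. *)
Lemma covering_outcome_cball (c : R) : 0 < c ->
  (forall (x : X) rho, 0 < rho -> rho <= 1 -> mass t (cball x rho) <= c * rho `^ t) ->
  exists2 C : R, 0 < C & forall rho q x, 0 < rho -> rho < q ->
    (covering_number rho (cball x q `&` Z) <= (C * (q / rho) `^ s)%:E)%E.
Proof.
move=> c0 mc.
(* The bound 1/2 keeps the doubled radii used below at most 1. *)
have [|m rm] := @exists_round 2^-1; first by rewrite invr_gt0.
have rm1 : r m <= 1 by lra.
have [C C0 H] := covering_global rm1.
pose D := c * 2 `^ t * ((2 / alpha) `^ t * (4 / beta) `^ s) * gamma^-1 `^ s.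
have D0 : 0 < D by rewrite !mulr_gt0 ?powR_gt0 ?divr_gt0 ?invr_gt0.
have qrho (rho q : R) : 0 < rho -> rho < q -> 1 <= q / rho.
  by move=> rho0 rq; rewrite ler_pdivlMr// mul1r ltW.
exists (Num.max C D); first by rewrite lt_max C0.
move=> rho q x rho0 rq; have q1 := qrho _ _ rho0 rq.
have q0 : 0 < q by exact: lt_trans rq.
have [rmq|qrm] := leP (r m) q.
  apply: le_trans (covering_number_mono (lexx rho) (@subIsetr _ _ _)) _.
  apply: le_trans (H rho rho0) _; rewrite lee_fin.
  rewrite ler_pM ?powR_ge0 ?(ltW C0)//; first by rewrite le_max lexx.
  rewrite ge0_ler_powR ?nnegrE ?le_max ?ler01 ?divr_ge0 ?(ltW q0) ?(ltW rho0) ?(ltW (r_gt0 m))//.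
  by rewrite ge_max q1 ler_wpM2r ?invr_ge0 ?(ltW rho0).
have [|k hk] := @exists_round (q / 2); first by rewrite divr_gt0.
have ex : exists k, r (m + k).+1 < q.
  exists k; have := r_le k (m.+1); rewrite addnS addnC => h.
  by apply: le_lt_trans h _; lra.
(* Round m + n is the last one with radius at least q, so this radius is at most q / gamma. A
   minimal index 0 is settled by q < r_m. *)
have [n [rn qn]] : exists n, r (m + n).+1 < q /\ q <= r (m + n)%N.
  case: (ex_minnP ex) => -[|n] hn nmin; first by exists 0%N; rewrite hn addn0 ltW.
  exists n.+1; rewrite hn; split=> //; rewrite leNgt addnS; apply/negP => /nmin.
  by rewrite ltnn.
have rmn : r (m + n)%N <= 2^-1 by exact: le_trans (r_le _ _) rm.
(* Answer balls meeting [cball x q] lie within q + 2 alpha r <= 2 r of x, where r = r_(m+n), and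
   they are disjoint. *)
have Bm : total (cball x q) (m + n) <= c * 2 `^ t * r (m + n)%N `^ t.
  apply: (@le_trans _ _ (mass t (cball x (2 * r (m + n)%N)))).
    rewrite /total -big_filter; apply: mass_sum => //.
    - by rewrite filter_uniq// (response_uniq (r_gt0 _) (SK _)).
    - move=> p; rewrite mem_filter => /andP[/asboolP[y [py xy]] pS].
      apply: cball_sub; move: py xy; rewrite /cball/= => py xy.
      have := metric_triangle x y p.2; rewrite (metric_sym y).
      have := ler_wpM2r (ltW (r_gt0 (m + n)%N)) alpha16.
      by have := r_gt0 (m + n)%N; lra.
    - move=> p p'; rewrite !mem_filter => /andP[_ pS] /andP[_ p'S] pp'.
      apply: subsetI_eq0 (response_disjoint (SK _) pS p'S pp'); exact: answer_sub.
  apply: le_trans (mc _ _ _ _) _; first by rewrite mulr_gt0.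
    by lra.
  by rewrite powRM ?(ltW (r_gt0 _))// mulrA.
have rmn1 : r (m + n)%N <= 1 by lra.
have c2 : 0 <= c * 2 `^ t by rewrite mulr_ge0 ?powR_ge0 ?ltW.
apply: le_trans (covering_total rmn1 c2 Bm rho0) _; rewrite lee_fin.
apply: (@le_trans _ _ (D * (q / rho) `^ s)); last first.
  by rewrite ler_wpM2r ?powR_ge0// le_max lexx orbT.
rewrite /D -!mulrA !ler_wpM2l ?powR_ge0 ?(ltW c0)//.
have gq0 : 0 <= gamma^-1 * (q / rho).
  by rewrite mulr_ge0 ?divr_ge0 ?invr_ge0 ?(ltW gamma0) ?(ltW q0) ?(ltW rho0).
rewrite -powRM ?divr_ge0 ?invr_ge0 ?(ltW gamma0) ?(ltW q0) ?(ltW rho0)//.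
rewrite ge0_ler_powR ?nnegrE ?le_max ?ler01// ge_max; apply/andP; split.
  rewrite -[leLHS]mulr1 ler_pM//.
  by rewrite invf_ge1// ltW.
have h : r (m + n)%N <= gamma^-1 * q by rewrite ler_pdivlMl// -rS ltW.
have rho_ge0 : 0 <= rho^-1 by rewrite invr_ge0 ltW.
by rewrite [leLHS]mulrA [leRHS]mulrA; exact: (ler_wpM2r rho_ge0 h).
Qed.

End counting.

(** * Dimensions *)

Section numeric.
Context {R : realType}.

(** Take d - e and d + e: the inequality reads gamma^(-2e) <= 2, true for small e, and e <= d/2
    keeps the lower exponent nonnegative. *)
Lemma exists_exponents (gamma d : R) : 0 < gamma -> gamma < 1 -> 0 < d ->
  exists s t : R, [/\ 0 <= s, s < d, d < t & gamma `^ s <= 2 * gamma `^ t].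
Proof.
move=> g0 g1 d0; have lg : ln gamma < 0 by rewrite ln_lt0// g0.
have l2 : 0 < ln 2 :> R by rewrite ln_gt0// ltr1n.
pose e := Num.min (d / 2) (ln 2 / (- 2 * ln gamma)).
have e0 : 0 < e by rewrite lt_min !divr_gt0//; lra.
have ed : e <= d / 2 by rewrite ge_min lexx.
have el : e * (- 2 * ln gamma) <= ln 2.
  by rewrite -ler_pdivlMr ?ge_min ?lexx ?orbT//; lra.
exists (d - e), (d + e); split; [lra..|].
have -> : 2 * gamma `^ (d + e) = expR (ln 2 + (d + e) * ln gamma).
  by rewrite expRD lnK ?posrE// /powR gt_eqF.
by rewrite /powR gt_eqF// ler_expR; lra.
Qed.

Lemma powRN_dominates (C a b : R) : 0 < C -> a < b -> exists2 e : R, 0 < e < 1 &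
  forall r, 0 < r -> r < e -> r `^ (- a) < C * r `^ (- b).
Proof.
move=> C0 ab; have ba : 0 < b - a by rewrite subr_gt0.
exists (Num.min 2^-1 (C `^ (b - a)^-1)) => [|r r0].
  by rewrite lt_min gt_min powR_gt0// invr_gt0 ltr0n invf_lt1 ?ltr1n.
rewrite lt_min => /andP[_ rC].
have -> : r `^ (- a) = r `^ (b - a) * r `^ (- b).
  by rewrite -powRD ?(gt_eqF r0) ?implybT//; congr powR; lra.
rewrite ltr_pM2r ?powR_gt0//.
have -> : C = (C `^ (b - a)^-1) `^ (b - a).
  by rewrite -powRrM mulVf ?gt_eqF// powRr1 ?ltW.
by rewrite gt0_ltr_powR ?nnegrE ?powR_ge0 ?(ltW r0).
Qed.

Lemma at_right0_small (V : set R) (e : R) : (0^'+ : set_system R) V -> 0 < e ->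
  exists r, [/\ V r, 0 < r & r < e].
Proof.
move=> V0 e0; have [r [Vr [r0 re]]] := filter_ex (filterI V0
  (filterI (nbhs_right_gt (0 : R)) (nbhs_right_lt e0))).
by exists r; split.
Qed.

End numeric.

(** * Box dimensions and power bounds on covering numbers *)

Section box.
Context {R : realType} {X : metricType R}.
Implicit Types (K : set X).

Lemma box_ratio_le K (r tau : R) : K !=set0 -> 0 < r -> r < 1 ->
  (box_ratio K r <= tau%:E)%E = (covering_number r K <= (r `^ (- tau))%:E)%E.
Proof.
move=> K0 r0 r1; have lr : 0 < - ln r by rewrite oppr_gt0 ln_lt0// r0.
rewrite /box_ratio inver gt_eqF// lee_pdivrMr// -EFinM.
have -> : tau * - ln r = ln (r `^ (- tau)) by rewrite ln_powR; lra.
rewrite -lne_EFin ?powR_gt0// lee_lne// in_itv/= ?leey ?andbT ?lee_fin ?powR_ge0//.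
by apply: le_trans (covering_number_ge1 r K0); rewrite lee_fin.
Qed.

(** Raising the exponent to s + e absorbs [C] at small radii, and every neighbourhood of 0+ contains
    such radii. *)
Lemma lower_box_dim_le K (C s r0 : R) : K !=set0 -> 0 < C -> 0 < r0 ->
  (forall r, 0 < r -> r < r0 -> (covering_number r K <= (C * r `^ (- s))%:E)%E) ->
  (lower_box_dim K <= s%:E)%E.
Proof.
move=> K0 C0 r00 H; apply/lee_addgt0Pr => e e0.
rewrite /lower_box_dim limf_einfE; apply: ge_ereal_sup => _ [V V0 <-].
have Ci : 0 < C^-1 by rewrite invr_gt0.
have se : s < s + e by rewrite ltrDl.
have [d /andP[d0 d1] hd] := powRN_dominates Ci se.
have [|r [Vr rpos]] := @at_right0_small _ V (Num.min d r0) V0.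
  by rewrite lt_min d0.
rewrite lt_min => /andP[rd rr0].
apply: ge_ereal_inf; exists (box_ratio K r); first by exists r.
rewrite -EFinD box_ratio_le//; last exact: lt_trans rd d1.
apply: le_trans (H r rpos rr0) _; rewrite lee_fin -ler_pdivlMl//.
exact/ltW/hd.
Qed.

Lemma upper_box_dim_ge K (C s r0 : R) : K !=set0 -> 0 < C -> 0 < r0 ->
  (forall r, 0 < r -> r < r0 -> ((C * r `^ (- s))%:E <= covering_number r K)%E) ->
  (s%:E <= upper_box_dim K)%E.
Proof.
move=> K0 C0 r00 H; apply/lee_addgt0Pr => e e0.
rewrite -leeBlDr// -EFinB /upper_box_dim limf_esupE.
apply: le_ereal_inf_tmp => _ [V V0 <-].
have se : s - e < s by lra.
have [d /andP[d0 d1] hd] := powRN_dominates C0 se.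
have [|r [Vr rpos]] := @at_right0_small _ V (Num.min d r0) V0.
  by rewrite lt_min d0.
rewrite lt_min => /andP[rd rr0].
apply: le_ereal_sup_tmp; exists (box_ratio K r); first by exists r.
rewrite leNgt; apply/negP => /ltW; rewrite box_ratio_le//; last exact: lt_trans rd d1.
by apply/negP; rewrite -ltNge (lt_le_trans _ (H r rpos rr0))// lte_fin hd.
Qed.

Lemma upper_box_dim_lt K (tau : R) : K !=set0 -> (upper_box_dim K < tau%:E)%E ->
  exists2 e : R, 0 < e < 1 & forall r, 0 < r -> r < e ->
    (covering_number r K <= (r `^ (- tau))%:E)%E.
Proof.
move=> K0; rewrite /upper_box_dim limf_esupE => /ereal_inf_lt[_ [V V0 <-] Vtau].
have /nbhs_ballP[e /= e0 He] := V0.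
exists (Num.min e 2^-1) => [|r r0].
  by rewrite lt_min e0 gt_min invr_gt0 ltr0n invf_lt1 ?ltr1n// orbT.
rewrite lt_min => /andP[re r2]; rewrite -box_ratio_le//; last by lra.
apply: le_trans (ltW Vtau); apply: ereal_sup_ubound; exists r => //.
by apply: He => //; rewrite /ball/= sub0r normrN gtr0_norm.
Qed.

End box.

(** * Upper bounds on packing weights *)

Section mass_bounds.
Context {R : realType} {X : completeMetricType R}.

Lemma finite_mass_bound (t c : R) (A : set X) :
  (forall s, packing A s -> weight t s <= c) -> finite_mass t A.
Proof. by move=> H; exists c => _ [s sA <-]; exact: H. Qed.

(* Uniform perfectness bounds the radius of a ball inside [cball x rho] by a
   multiple of [rho]. *)
Lemma weight_cball_le (kappa t s C : R) : 0 < kappa < 1 ->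
  (forall (x : X) r, 0 < r -> r <= 1 ->
    exists z, kappa * r < mdist x z /\ mdist x z <= r) ->
  s < t -> 0 < C ->
  (forall r q (x : X), 0 < r -> r < q ->
    (covering_number r (cball x q) <= (C * (q / r) `^ s)%:E)%E) ->
  exists2 c : R, 0 < c & forall (x : X) rho l, 0 < rho ->
    packing (cball x rho) l -> weight t l <= c * rho `^ t.
Proof.
move=> /andP[k0 k1] annulus st C0 cov.
have h0 : 0 < 1 - 2^-1 `^ (t - s) :> R by rewrite half_powR_lt1// subr_gt0.
exists (C / (1 - 2^-1 `^ (t - s)) * (2 / kappa) `^ t).
  by rewrite mulr_gt0 ?divr_gt0 ?powR_gt0 ?divr_gt0.
move=> x rho l rho0 lx; pose Q := 2 / kappa * rho.
have Q0 : 0 < Q by rewrite mulr_gt0 ?divr_gt0.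
have rhoQ : rho <= Q.
  by rewrite ler_peMl ?(ltW rho0)// ler_pdivlMr// mul1r; lra.
rewrite -mulrA -powRM ?(ltW rho0) ?divr_ge0 ?(ltW k0)//.
apply: (weight_le Q0 (ltW C0) st) lx.
- move=> p px; pose a : R := 2^-1 ^+ p.1.
  have a0 : 0 < a by rewrite exprn_gt0// invr_gt0.
  have a1 : a <= 1 by rewrite exprn_ile1 ?invr_ge0// invf_le1 ?ler1n.
  have [z [az za]] := annulus p.2 a a0 a1.
  have xz : mdist x z <= rho by apply: px.
  have xp : mdist x p.2 <= rho by apply: px; exact: pball_center.
  have := metric_triangle p.2 x z; rewrite (metric_sym _ x) => pz.
  rewrite /Q mulrAC ltr_pdivlMr// mulrC; rewrite -/a; lra.
- move=> k kQ; apply: le_trans (covering_number_mono (lexx _) _) _.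
    by apply: (@cball_sub _ _ x x Q rho); rewrite mdistxx add0r.
  by apply: cov; rewrite // exprn_gt0// invr_gt0.
Qed.

Lemma weight_bounded (t s e : R) : 0 <= s -> s < t -> 0 < e < 1 ->
  (forall r, 0 < r -> r < e ->
    (covering_number r [set: X] <= (r `^ (- s))%:E)%E) ->
  exists c : R, forall (A : set X) l, packing A l -> weight t l <= c.
Proof.
move=> s0 st /andP[e0 e1] cov.
(* Radii of at least [e] escape the hypothesis; their covering numbers are bounded by the one at
   scale e/2, hence by [C]. *)
pose C : R := (e / 2) `^ (- s).
have C1 : 1 <= C.
  by rewrite -[leLHS](@powRr0 _ (e / 2)) ger_powR ?oppr_le0//; apply/andP; split; lra.
have C0 : 0 <= C by exact: le_trans C1.
exists (C / (1 - 2^-1 `^ (t - s)) * 2 `^ t) => A l /(packingS (@subsetT _ A)).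
apply: weight_le => //.
- move=> p _; apply: (@le_lt_trans _ _ 1); last by rewrite ltr1n.
  by rewrite exprn_ile1 ?invr_ge0// invf_le1 ?ler1n.
- move=> k _; set a : R := 2^-1 ^+ k.
  have a0 : 0 < a by rewrite exprn_gt0// invr_gt0.
  have a1 : a <= 1 by rewrite exprn_ile1 ?invr_ge0// invf_le1 ?ler1n.
  have aN : a `^ (- s) <= (2 / a) `^ s.
    rewrite powRN -powRV ?(ltW a0)//.
    by rewrite ge0_ler_powR ?nnegrE ?divr_ge0 ?invr_ge0 ?(ltW a0)// ler_peMl ?invr_ge0 ?(ltW a0)// ler1n.
  have a2 : 1 <= (2 / a) `^ s.
    apply: le_trans aN; rewrite -[leLHS](@powRr0 _ a) ger_powR ?a0 ?a1 ?oppr_le0//.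
  have [ae|ea] := ltP a e.
    apply: le_trans (cov a a0 ae) _; rewrite lee_fin; apply: le_trans aN _.
    by rewrite ler_peMl ?powR_ge0.
  apply: (@le_trans _ _ (covering_number (e / 2) [set: X])).
    by apply: covering_number_mono => //; lra.
  apply: le_trans (cov _ _ _) _; [lra..|].
  by rewrite lee_fin ler_peMr.
Qed.

End mass_bounds.

(** * The winning strategy *)

Section strategy.
Context {R : realType} {X : completeMetricType R}.
Variables (kappa t s beta : R).
Hypotheses (kappa01 : 0 < kappa < 1) (t0 : 0 <= t) (s0 : 0 <= s)
  (beta01 : 0 < beta < 1).
Hypothesis annulus : forall (x : X) r, 0 < r -> r <= 1 ->
  exists z, kappa * r < mdist x z /\ mdist x z <= r.
Hypothesis fin : forall (x : X) (r : R), finite_mass t (cball x r).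
Let alpha := kappa / 16.
Hypothesis st : (alpha * beta) `^ s <= 2 * (alpha * beta) `^ t.

(** The net is chosen together with Alice's set because the counting refers to it; for r <= 0 a
    dummy value keeps the choice total. *)
Lemma exists_answer (K : compacts X) (r : R) :
  exists Sy : seq (X * X) * compacts X, 0 < r ->
    response t alpha K r Sy.1 /\
    forall y, cset Sy.2 y <-> exists2 p, p \in Sy.1 & y = p.2.
Proof.
have [r0|] := pselect (0 < r); last by exists ([::], K).
have [S SK] := exists_response K fin kappa01 (erefl alpha) annulus r0.
pose A := [set y | exists2 p, p \in S & y = p.2].
have cA : compact A.
  have -> : A = snd @` [set` S].
    by apply/seteqP; split=> y [p pS pE]; exists p.
  exact/finite_compact/finite_image/finite_seq.
have A0 : A !=set0.
  have [k Kk] := cset_neq0 K; have [_ /(_ k Kk)[p pS _] _ _ _] := SK.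
  by exists p.2, p.
by exists (S, Compacts cA A0).
Qed.

(** One strategy serves both dimensions, which differ only in the covering estimate that places the
    outcome in [T]. *)
Lemma winning_with_covering (T : set (compacts X)) :
  (forall Z : compacts X,
    (exists C rho0 : R, [/\ 0 < C, 0 < rho0 & forall rho, 0 < rho ->
      (covering_number rho Z <= (C * Num.max 1 (rho0 / rho) `^ s)%:E)%E]) ->
    (forall c : R, 0 < c ->
      (forall (x : X) rho, 0 < rho -> rho <= 1 ->
        mass t (cball x rho) <= c * rho `^ t) ->
      exists2 C : R, 0 < C & forall rho q x, 0 < rho -> rho < q ->
        (covering_number rho (cball x q `&` Z) <= (C * (q / rho) `^ s)%:E)%E) ->
    T Z) ->
  winning_with alpha beta T.
Proof.
move=> HT; have /andP[k0 k1] := kappa01; have /andP[b0 b1] := beta01.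
have a0 : 0 < alpha by rewrite /alpha; lra.
have a16 : alpha <= 16^-1 by rewrite /alpha; lra.
pose ans K := projT1 (choice (exists_answer K)).
have ansP K r := projT2 (choice (exists_answer K)) r.
pose K0 := Compacts (@compact_set1 X point) (ex_intro _ point erefl).
(* The answer depends only on Bob's last centre and current radius. The list has n + 1 entries in
   round n, hence the predecessor; [K0] is only the default of [last]. *)
exists (fun r0 xs => (ans (last K0 xs) ((alpha * beta) ^+ (size xs).-1 * r0)).2).
move=> r0 x r00 r y bob.
have r_gt0 n : 0 < r n by rewrite mulr_gt0// exprn_gt0// mulr_gt0.
have yE n : y n = (ans (x n) (r n)).2.
  by rewrite /y /alice_move size_mkseq -nth_last size_mkseq nth_mkseq.
have legal n : alice_legal alpha (r n) (x n) (y n).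
  have [[SK SKx _ Sp _] Y] := ansP (x n) (r n) (r_gt0 n).
  (* The constant is 1/2 for the net plus 1/8 for the displacement, and 5/8 + alpha <= 1. *)
  rewrite /alice_legal; suff : mdist (x n) (y n) <= 5 / 8 * r n.
    have := ler_wpM2r (ltW (r_gt0 n)) a16; have := r_gt0 n; lra.
  rewrite yE; apply: hausdorff_le => [a /SKx[p pS ap]|b /Y[p pS ->]].
    exists p.2; first by apply/Y; exists p.
    apply: le_trans (metric_triangle a p.1 p.2) _.
    by have := Sp p pS; lra.
  exists p.1; first exact: SK.
  by rewrite metric_sym; have := Sp p pS; have := r_gt0 n; lra.
split=> [n _|bobn]; first exact: legal.
have ab0 : 0 < alpha * beta by exact: mulr_gt0.
have ab1 : alpha * beta < 1.
  by apply: le_lt_trans b1; rewrite ler_piMl ?(ltW b0)//; lra.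
have rS n : r n.+1 = alpha * beta * r n by rewrite /r exprS mulrA.
have [||n|Z ZE] := @compacts_nested _ _ x r.
- by move=> n; exact: ltW.
- move=> e e0; have [n hn] := exists_expr_le ab0 ab1 (divr_gt0 e0 r00).
  by exists n; rewrite /r -ler_pdivlMr.
- have := legal n; have := bobn n; rewrite /bob /bob_legal /alice_legal rS.
  have := metric_triangle (x n) (y n) (x n.+1); lra.
exists Z => //.
have KZ n : mdist (x n) Z <= r n.
  have : (\bigcap_n cball (x n) (r n)) Z by rewrite ZE.
  by move=> /(_ n I).
have SK n : response t alpha (x n) (r n) (ans (x n) (r n)).1.
  by have [] := ansP (x n) (r n) (r_gt0 n).
have YS n b : cset (y n) b -> exists2 p, p \in (ans (x n) (r n)).1 & b = p.2.
  by rewrite yE; have [_ Y] := ansP (x n) (r n) (r_gt0 n) => /Y.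
apply: HT.
- exact: (covering_outcome t0 s0 a0 a16 b0 b1 r00 st fin SK YS bobn KZ).
- move=> c.
  exact: (covering_outcome_cball t0 s0 a0 a16 b0 b1 r00 st fin SK YS bobn KZ).
Qed.

End strategy.

(** * Positivity of the dimensions of the space *)

Section dimensions_pos.
Context {R : realType} {X : completeMetricType R}.
Hypothesis perfectX : uniformly_perfect X.

(** On a ball of radius 1, C r^-s <= C' r^-s' for all small r forces s <= s'. Positivity leaves room
    for a nonnegative exponent strictly below the dimension. *)
Lemma assouad_dim_gt0 : (0 < assouad_dim [set: X])%E.
Proof.
have [s [C [s0 C0 H]]] := uniformly_perfect_covering perfectX.
apply: (@lt_le_trans _ _ s%:E); first by rewrite lte_fin.
apply: le_ereal_inf_tmp => _ [s' [_ [C' C'0 H']] <-].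
rewrite lee_fin leNgt; apply/negP => ss'.
have [e /andP[e0 e1] he] := powRN_dominates (divr_gt0 C0 C'0) ss'.
have e2 : 0 < e / 2 by rewrite divr_gt0.
have e21 : e / 2 < 1 by lra.
have e2e : e / 2 < e by lra.
have := le_trans (H _ _ point e2 e21 (lexx 1)).
move=> /(_ _ _); have := H' (e / 2) 1 point e2 e21 Logic.I.
rewrite setIT => h /(_ _ h); rewrite lee_fin.
rewrite !div1r !powRV ?(ltW e2)// -!powRN => le.
have := he _ e2 e2e; rewrite ltNge => /negP; apply.
by rewrite mulrAC ler_pdivrMr// [leRHS]mulrC.
Qed.

Lemma upper_box_dim_gt0 : (0 < upper_box_dim [set: X])%E.
Proof.
have [s [C [s0 C0 H]]] := uniformly_perfect_covering perfectX.
apply: (@lt_le_trans _ _ s%:E); first by rewrite lte_fin.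
apply: (@upper_box_dim_ge _ _ _ C s 1) => //; first by exists point.
move=> r r0 r1; apply: le_trans (covering_number_mono (lexx r) (@subsetT _ _)).
by apply: le_trans (H r 1 point r0 r1 (lexx 1)); rewrite div1r powRV ?(ltW r0)// powRN.
Qed.

End dimensions_pos.

Theorem theorem2p4 (R : realType) (X : completeMetricType R)
    (sepX : separable X) (doublingX : doubling X)
    (perfectX : uniformly_perfect X) :
  winning [set K : compacts X | (assouad_dim K < assouad_dim [set: X])%E] /\
  ((upper_box_dim [set: X] < +oo)%E ->
    winning [set K : compacts X |
      (lower_box_dim K < upper_box_dim [set: X])%E]).
Proof.
have [kappa [k01 annulus]] := uniformly_perfect_annulus perfectX.
have /andP[k0 k1] := k01.
have a01 : 0 < kappa / 16 < 1 by apply/andP; split; lra.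
have gamma01 beta : 0 < beta < 1 ->
    0 < kappa / 16 * beta /\ kappa / 16 * beta < 1.
  move=> /andP[b0 b1]; split; first by rewrite mulr_gt0// divr_gt0.
  by apply: le_lt_trans b1; rewrite ler_piMl ?(ltW b0)//; lra.
split=> [|boxX]; exists (kappa / 16) => // beta b01;
  have [g0 g1] := gamma01 beta b01.
- have dpos := assouad_dim_gt0 perfectX.
  have := doublingX; rewrite /doubling.
  case E : (assouad_dim [set: X]) dpos => [d| |]//; rewrite lte_fin => d0 _.
  have [s [t [s0 sd dt stg]]] := exists_exponents g0 g1 d0.
  have : (assouad_dim [set: X] < t%:E)%E by rewrite E lte_fin.
  move=> /ereal_inf_lt[_ [s1 [s10 [C C0 cov]] <-]]; rewrite lte_fin => s1t.
  have [|c c0 wc] := weight_cball_le k01 annulus s1t C0.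
    by move=> r q x r0 rq; have := cov r q x r0 rq Logic.I; rewrite setIT.
  have t0 : 0 <= t by lra.
  have fin (x : X) r : finite_mass t (cball x r).
    (* The weight bound is for positive radii, so the ball is enlarged to cover r <= 0 too. *)
    apply: (@finite_massS _ _ _ _ (cball x (Num.max 1 r))).
      by apply: cball_sub; rewrite mdistxx add0r le_max lexx orbT.
    apply: finite_mass_bound => l; apply: wc.
    by rewrite lt_max ltr01.
  apply: (winning_with_covering k01 t0 s0 b01 annulus fin stg) => Z _ HZ /=.
  have [|C' C'0 covZ] := HZ c c0.
    by move=> x rho rho0 _; apply: mass_le => l; exact: wc.
  apply: (@le_lt_trans _ _ s%:E); last by rewrite lte_fin.
  apply: ereal_inf_lbound; exists s => //; split=> //; exists C' => //.
  by move=> r q x r0 rq _; exact: covZ.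
- have dpos := upper_box_dim_gt0 perfectX.
  move: boxX dpos; case E : (upper_box_dim [set: X]) => [d| |]// _.
  rewrite lte_fin => d0.
  have [s [t [s0 sd dt stg]]] := exists_exponents g0 g1 d0.
  (* The midpoint exceeds d, so the covering bound holds at small radii, and stays below t, so the
     geometric series converges. *)
  have [||e e01 cov] := @upper_box_dim_lt _ _ [set: X] ((d + t) / 2).
  + by exists point.
  + by rewrite E lte_fin; lra.
  have [||c wc] := weight_bounded (t := t) _ _ e01 cov; [lra..|].
  have t0 : 0 <= t by lra.
  have fin (x : X) r : finite_mass t (cball x r).
    by apply: finite_mass_bound => l; exact: wc.
  apply: (winning_with_covering k01 t0 s0 b01 annulus fin stg) => Z HZ _ /=.
  have [C [rho0 [C0 rho00 covZ]]] := HZ.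
  apply: (@le_lt_trans _ _ s%:E); last by rewrite lte_fin.
  apply: (@lower_box_dim_le _ _ _ (C * rho0 `^ s) _ rho0) => //.
  + exact: cset_neq0.
  + by rewrite mulr_gt0// powR_gt0.
  + move=> r r0 rr; have := covZ r r0; rewrite (max_idPr _); last first.
      by rewrite ler_pdivlMr// mul1r ltW.
    by rewrite powRM ?invr_ge0 ?(ltW r0) ?(ltW rho00)// powRV ?(ltW r0)// powRN mulrA.
Qed.
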